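(* Let $\mathbf{k}$ be an algebraically closed field of characteristic zero and let $X_\sigma$ be an affine simplicial toric variety over $\mathbf{k}$ without torus factors, of dimension at least $4$, which is smooth in codimension $2$. Let $C$ and $C'$ be smooth polynomial curves in $X_\sigma$ contained in the regular locus of $X_\sigma$, and let $\varphi:C\to C'$ be an isomorphism. Then $\varphi$ extends to an automorphism of $X_\sigma$.
   Context: $X_\sigma=\mathrm{Spec}\,\mathbf{k}[\sigma^\vee\cap M]$ for a lattice $N\cong\mathbb Z^n$ with dual $M$ and a strongly convex rational polyhedral cone $\sigma\subset N_{\mathbb R}$. Simplicial means the primitive ray generators of $\sigma$ are linearly independent; no torus factors means every invertible regular function on $X_\sigma$ is constant (so $\sigma$ is generated by $n$ linearly independent vectors and $X_\sigma\cong\mathbb A^n/G$ for a finite abelian group $G$ acting diagonally). Smooth in codimension 2 means the singular locus has codimension at least $3$. A smooth polynomial curve is a closed curve isomorphic to $\mathbb{A}^1$. *)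

(* Defs.v *)
From HB Require Import structures.
From mathcomp Require Import all_boot all_order all_algebra.
Set Implicit Arguments. Unset Strict Implicit. Unset Printing Implicit Defensive.
Import Order.TTheory GRing.Theory Num.Theory.
Local Open Scope ring_scope.

Section Toric.
Variables (k : fieldType) (n : nat).

(* Lattice N = M = Z^n, represented by integer row vectors. *)
Definition pairing (m v : 'rV[int]_n) : int := \sum_(j < n) m ord0 j * v ord0 j.

(* The cone sigma is generated by the rows v i (i < n) of an integer matrix;
   simplicial with no torus factors = n linearly independent generators. *)
Definition simplicial_full (v : 'I_n -> 'rV[int]_n) : Prop :=
  \det (\matrix_(i < n, j < n) ((v i ord0 j)%:~R : rat)) != 0.

Definition inDual (v : 'I_n -> 'rV[int]_n) (m : 'rV[int]_n) : Prop :=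
  forall i, (0 <= pairing m (v i))%R.

Definition Pt := 'rV[int]_n -> k.

(* k-points of X_sigma = Spec k[sigma^vee \cap M]: monoid homomorphisms
   (sigma^vee \cap M, +) -> (k, mult), extended by 0 off the semigroup. *)
Definition isPoint v (x : Pt) : Prop :=
  [/\ x 0 = 1,
      (forall m m', inDual v m -> inDual v m' -> x (m + m') = x m * x m')
    & (forall m, ~ inDual v m -> x m = 0)].

Definition regular_fun v (g : Pt -> k) : Prop :=
  exists s : seq (k * 'rV[int]_n),
    (forall p, p \in s -> inDual v p.2) /\
    forall x, isPoint v x -> g x = \sum_(p <- s) p.1 * x p.2.

Definition morphism v (F : Pt -> Pt) : Prop :=
  (forall x, isPoint v x -> isPoint v (F x)) /\
  forall m, regular_fun v (fun x => F x m).

Definition automorphism v (F : Pt -> Pt) : Prop :=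
  morphism v F /\ exists G, morphism v G /\
    (forall x, isPoint v x -> G (F x) = x) /\
    (forall x, isPoint v x -> F (G x) = x).

(* Zariski tangent space at x: point-derivations of k[sigma^vee \cap M] at x,
   given by their values on the character basis. *)
Definition point_derivation v (x : Pt) (D : 'rV[int]_n -> k) : Prop :=
  (forall m m', inDual v m -> inDual v m' ->
       D (m + m') = x m * D m' + x m' * D m) /\
  (forall m, ~ inDual v m -> D m = 0).

(* x is a regular point: the tangent space has dimension n = dim X_sigma. *)
Definition regular_point v (x : Pt) : Prop :=
  isPoint v x /\
  exists B : 'I_n -> ('rV[int]_n -> k),
    (forall i, point_derivation v x (B i)) /\
    (forall D, point_derivation v x D ->
        exists c : 'I_n -> k, forall m, D m = \sum_(i < n) c i * B i m) /\
    (forall c : 'I_n -> k, (forall m, \sum_(i < n) c i * B i m = 0) ->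
        forall i, c i = 0).

Definition singular_point v (x : Pt) : Prop := isPoint v x /\ ~ regular_point v x.

Definition zclosed v (Z : Pt -> Prop) : Prop :=
  exists Fs : (Pt -> k) -> Prop,
    (forall g, Fs g -> regular_fun v g) /\
    forall x, Z x <-> (isPoint v x /\ forall g, Fs g -> g x = 0).

Definition irreducible_closed v (Z : Pt -> Prop) : Prop :=
  [/\ zclosed v Z, exists x, Z x &
      forall Z1 Z2, zclosed v Z1 -> zclosed v Z2 ->
        (forall x, Z x -> Z1 x \/ Z2 x) ->
        (forall x, Z x -> Z1 x) \/ (forall x, Z x -> Z2 x)].

Definition strict_subset (A B : Pt -> Prop) : Prop :=
  (forall x, A x -> B x) /\ exists x, B x /\ ~ A x.

(* Smooth in codimension 2: dim Sing(X) <= n - 3, i.e. there is no chain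
   Z_0 < Z_1 < ... < Z_(n-2) of irreducible closed subsets inside Sing(X). *)
Definition smooth_in_codim2 v : Prop :=
  ~ exists Z : nat -> (Pt -> Prop),
      (forall i, (i <= n - 2)%N -> irreducible_closed v (Z i) /\
                  forall x, Z i x -> singular_point v x) /\
      (forall i, (i < n - 2)%N -> strict_subset (Z i) (Z i.+1)).

(* Smooth polynomial curve: closed curve isomorphic to A^1, i.e. the image of
   a polynomial map gamma : A^1 -> X_sigma admitting a regular left inverse. *)
Definition smooth_polynomial_curve v (C : Pt -> Prop) : Prop :=
  exists gamma : k -> Pt,
    [/\ forall t, isPoint v (gamma t),
        forall m, exists p : {poly k}, forall t, gamma t m = p.[t],
        exists f, regular_fun v f /\ forall t, f (gamma t) = t
      & forall x, C x <-> exists t, x = gamma t].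

(* Morphism of closed subvarieties C -> C': pulls back characters to
   restrictions of regular functions. *)
Definition curve_morphism v (C C' : Pt -> Prop) (phi : Pt -> Pt) : Prop :=
  (forall x, C x -> C' (phi x)) /\
  forall m, exists g, regular_fun v g /\ forall x, C x -> g x = phi x m.

Definition curve_iso v (C C' : Pt -> Prop) (phi : Pt -> Pt) : Prop :=
  curve_morphism v C C' phi /\
  exists psi, curve_morphism v C' C psi /\
    (forall x, C x -> psi (phi x) = x) /\
    (forall y, C' y -> phi (psi y) = y).

End Toric.

(* Main.v *)
From mathcomp Require Import all_boot all_order all_algebra ring.
From Stdlib Require Import Classical ClassicalEpsilon FunctionalExtensionality.
Require Import Defs.
Set Implicit Arguments. Unset Strict Implicit. Unset Printing Implicit Defensive.
Import Order.TTheory GRing.Theory Num.Theory.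
Local Open Scope ring_scope.

(* The variety is the quotient of A^n by a finite group G acting diagonally.
   Smoothness in codimension 2 says that omitting any two coordinates leaves
   characters generating the dual of G; hence there are enough equivariant
   shears x_i += Q, with Q a semi-invariant of the same weight as x_i not
   involving x_i, and these descend to X_sigma.

   A line in the regular locus lifts to f = (f_1, ..., f_n) in k[t]^n: the
   covering is etale there, which shows up as integrality of the vanishing
   orders of the d-th powers of the coordinates.  Composing with phi, it is
   enough to connect two lifted lines f and f' by shears.

   A subalgebra of k[t] is everything as soon as it separates points and
   tangent vectors, which is tested by the divided differences
   (b(s) - b(t)) / (s - t).  After generic shears the f_i have no common zeros
   and f_1^d, f_2^d, f_3^d generate k[t].  When the invariants in the
   coordinates other than x_i restrict onto k[t], a shear replaces f_i by any
   polynomial.  Replacing the coordinates in turn by generic polynomials common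
   to f and f' brings both lines to the same normal form
   (1, h_2, h_3, h_4, 1, ..., 1); the fourth coordinate is what makes room for
   the replacement of one of the first three. *)

(** The group $G$ is never constructed: its character group is $\mathbb Z^n$ modulo the image of
    $M$, so weights are integer vectors compared modulo this lattice, and [d] kills the quotient,
    which makes every $x_i^d$ invariant. Omitting two coordinates is what the shears require: a
    shear of $x_i$ must avoid $x_i$ itself, and at a given point of the curve one further coordinate
    may vanish. Once no two $f_j$ share a zero, some monomial in the remaining coordinates has the
    desired weight and is nonzero at that point. Hence, if the invariants not involving $x_i$
    restrict onto $k[t]$, the semi-invariants of the weight of $x_i$ restrict to an ideal without
    zeros, that is, to all of $k[t]$. Three powers suffice to generate $k[t]$ because two of them
    already give a subalgebra containing a nonzero ideal $q\,k[t]$, and the third only has to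
    separate the finitely many pairs of roots of $q$. All genericity conditions are of this finite
    kind: a polynomial in the shear parameter must not be identically zero. Characteristic zero
    keeps the binomial coefficients of $(f+cq)^d$ from vanishing. *)

Section Univariate.
Variable k : closedFieldType.
Implicit Types (p q r b z : {poly k}) (s t c : k).

Lemma closed_root p : (1 < size p)%N -> exists x, root p x.
Proof. by move=> hp; apply/closed_rootP; rewrite neq_ltn hp orbT. Qed.

Lemma exists_nonroot p : p != 0 -> exists c, ~~ root p c.
Proof.
move=> p0; have h : (1 < size (p * 'X + 1)%R)%N.
  by rewrite size_MXaddC oner_eq0 andbF ltnS size_poly_gt0.
have [x] := closed_root h; rewrite rootE !hornerE => /eqP e; exists x.
apply/negP; rewrite rootE => /eqP e'; move: e; rewrite e' mul0r add0r.
by move/eqP; rewrite oner_eq0.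
Qed.

Lemma nth_root (c : k) e : (0 < e)%N -> exists y : k, y ^+ e = c.
Proof.
move=> e0; have [|x] := @closed_root ('X^e - c%:P).
  by rewrite size_XnsubC.
by rewrite rootE !hornerE => /eqP /subr0_eq h; exists x.
Qed.

Lemma poly_fun_inj p q : (forall t, p.[t] = q.[t]) -> p = q.
Proof.
move=> h; apply/eqP; rewrite -subr_eq0; apply/negPn/negP=> /exists_nonroot [c].
by rewrite rootE !hornerE h subrr eqxx.
Qed.

(** * Divided differences *)

(* [(p(s) - p(t)) / (s - t)], and [p'(s)] when [s = t]. *)
Definition divdiff s t p : k := (p %/ ('X - s%:P)).[t].

Lemma divdiffE s p : p = (p %/ ('X - s%:P)) * ('X - s%:P) + p.[s]%:P.
Proof. by rewrite {1}(divp_eq p ('X - s%:P)) modp_XsubC. Qed.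

Lemma divdiff_eq s t p q c : p = q * ('X - s%:P) + c%:P -> divdiff s t p = q.[t].
Proof.
move=> ->; rewrite /divdiff divpD mulpK ?polyXsubC_eq0 // divp_small ?addr0 //.
by rewrite size_XsubC size_polyC; case: (c != 0).
Qed.

Lemma divdiffD s t p q : divdiff s t (p + q) = divdiff s t p + divdiff s t q.
Proof. by rewrite /divdiff divpD hornerD. Qed.

Lemma divdiffZ s t c p : divdiff s t (c *: p) = c * divdiff s t p.
Proof. by rewrite /divdiff divpZl hornerZ. Qed.

Lemma divdiff_sum s t (I : Type) (r : seq I) (F : I -> {poly k}) :
  divdiff s t (\sum_(i <- r) F i) = \sum_(i <- r) divdiff s t (F i).
Proof.
elim: r => [|i r IH]; first by rewrite !big_nil /divdiff div0p horner0.
by rewrite !big_cons divdiffD IH.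
Qed.

Lemma divdiffC s t c : divdiff s t c%:P = 0.
Proof. by rewrite (@divdiff_eq _ _ _ 0 c) ?horner0 // mul0r add0r. Qed.

Lemma divdiffX s t : divdiff s t 'X = 1.
Proof. by rewrite (@divdiff_eq _ _ _ 1 s) ?hornerC // mul1r subrK. Qed.

Lemma divdiffM s t p q :
  divdiff s t (p * q) = divdiff s t p * q.[t] + p.[s] * divdiff s t q.
Proof.
rewrite (@divdiff_eq _ _ _ ((p %/ ('X - s%:P)) * q + p.[s] *: (q %/ ('X - s%:P))) (p.[s] * q.[s])).
  by rewrite !hornerE.
have ep := divdiffE s p; have eq := divdiffE s q.
set P := p %/ _ in ep *; set Q := q %/ _ in eq *.
transitivity ((P * ('X - s%:P) + p.[s]%:P) * q); first by rewrite -ep.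
transitivity (P * ('X - s%:P) * q + p.[s]%:P * (Q * ('X - s%:P) + q.[s]%:P)).
  by rewrite -eq mulrDl.
by rewrite -mul_polyC polyCM; ring.
Qed.

(** Vanishing means that [p] is constant on the length-two subscheme defined by $(X-s)(X-t)$, which
    is a tangent vector when $s=t$; points and tangent vectors are thus treated together. *)
Lemma divdiff0P s t p :
  reflect (exists c, ('X - s%:P) * ('X - t%:P) %| p - c%:P) (divdiff s t p == 0).
Proof.
apply: (iffP eqP) => [h|[c /dvdpP [q /eqP]]].
  exists p.[s]; have -> : p - p.[s]%:P = ('X - s%:P) * (p %/ ('X - s%:P)).
    by rewrite {1}(divdiffE s p) addrK mulrC.
  by rewrite dvdp_mul2l ?polyXsubC_eq0 // dvdp_XsubCl rootE; apply/eqP.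
rewrite subr_eq => /eqP e; rewrite (@divdiff_eq _ _ _ (q * ('X - t%:P)) c).
  by rewrite !hornerE subrr mulr0.
by rewrite e; ring.
Qed.

Lemma divdiff_mod s t p q :
  ('X - s%:P) * ('X - t%:P) %| p - q -> divdiff s t p = divdiff s t q.
Proof.
move=> h; have -> : p = (p - q) + q by rewrite subrK.
by rewrite divdiffD (eqP (introT (divdiff0P s t (p - q)) _)) ?add0r //; exists 0; rewrite subr0.
Qed.

(** * Subalgebras of the polynomial ring *)

Record subalgebra (B : {poly k} -> Prop) : Prop := Subalgebra {
  subalg1 : B 1;
  subalgL : forall c p q, B p -> B q -> B (c *: p + q);
  subalgM : forall p q, B p -> B q -> B (p * q) }.

Section Subalgebra.
Variables (B : {poly k} -> Prop) (hB : subalgebra B).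

Lemma subalg0 : B 0.
Proof. by have := subalgL hB (-1) (subalg1 hB) (subalg1 hB); rewrite scaleN1r addNr. Qed.

Lemma subalgZ c p : B p -> B (c *: p).
Proof. by move=> hp; have := subalgL hB c hp subalg0; rewrite addr0. Qed.

Lemma subalgD p q : B p -> B q -> B (p + q).
Proof. by move=> hp hq; have := subalgL hB 1 hp hq; rewrite scale1r. Qed.

Lemma subalgC c : B c%:P.
Proof. by rewrite -[c%:P]mulr1 mul_polyC; apply: subalgZ; apply: subalg1. Qed.

Lemma subalg_sum (I : Type) (r : seq I) (F : I -> {poly k}) :
  (forall i, B (F i)) -> B (\sum_(i <- r) F i).
Proof.
move=> h; elim: r => [|i r IH]; first by rewrite big_nil; exact: subalg0.
by rewrite big_cons; apply: subalgD.
Qed.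

Lemma subalgX p e : B p -> B (p ^+ e).
Proof.
move=> hp; elim: e => [|e IH]; first by rewrite expr0; exact: subalg1.
by rewrite exprS; apply: subalgM.
Qed.

Lemma subalg_comp p q : B q -> B (p \Po q).
Proof.
move=> hq; rewrite comp_polyE; apply: subalg_sum => i.
by apply: subalgZ; apply: subalgX.
Qed.

Lemma subalg_eq_all : B 'X -> forall p, B p.
Proof. by move=> hX p; rewrite -(comp_polyXr p); apply: subalg_comp. Qed.

Definition separates z := forall s t, root z s -> root z t ->
  exists2 b, B b & divdiff s t b != 0.

(** Newton interpolation over the roots of [z] listed with multiplicity. For roots $x$, $a$ some
    $b-b(x)$ with $b$ in [B] is $X-x$ times a polynomial nonzero at $a$; products of such elements
    replace the Newton basis, so multiple roots need no higher-order condition. *)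
Lemma separates_surj_mod z : z != 0 -> separates z ->
  forall p, exists2 b, B b & z %| p - b.
Proof.
move=> z0 hz; have [rs zE] := closed_field_poly_normal z.
have lz : lead_coef z != 0 by rewrite lead_coef_eq0.
have {}hz s t : s \in rs -> t \in rs -> exists2 b, B b & divdiff s t b != 0.
  by move=> hs ht; apply: hz; rewrite zE rootZ // root_prod_XsubC.
suff h p : exists2 b, B b & \prod_(x <- rs) ('X - x%:P) %| p - b.
  by move=> p; have [b] := h p; exists b => //; rewrite zE dvdpZl.
have unitat a rs' : a \in rs -> {subset rs' <= rs} ->
    exists2 w, B (\prod_(x <- rs') ('X - x%:P) * w) & w.[a] != 0.
  move=> ha; elim: rs' => [|x rs' IH] hs.
    by exists 1; rewrite ?big_nil ?mulr1 ?hornerC ?oner_eq0 //; apply: subalg1.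
  have [w hw wa] := IH (fun y hy => hs y (mem_behead (s := x :: rs') hy)).
  have [b hb db] := hz x a (hs x (mem_head _ _)) ha.
  exists ((b %/ ('X - x%:P)) * w); last by rewrite hornerM mulf_neq0.
  have -> : \prod_(y <- x :: rs') ('X - y%:P) * (b %/ ('X - x%:P) * w) =
    (b - (b.[x])%:P) * (\prod_(y <- rs') ('X - y%:P) * w).
    by rewrite big_cons {2}(divdiffE x b) addrK; ring.
  by apply: subalgM => //; rewrite -scaleN1r addrC; apply: subalgL => //; apply: subalgC.
move: p; have : {subset rs <= rs} by [].
elim: {-2}rs => [|a rs' IH] hs p.
  by exists 0; rewrite ?big_nil ?dvd1p //; exact: subalg0.
have ha := hs a (mem_head _ _); have hs' y (hy : y \in rs') := hs y (mem_behead (s := a :: rs') hy).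
have [b0 hb0 /dvdpP [r er]] := IH hs' p.
have [w hw wa] := unitat a rs' ha hs'.
exists ((r.[a] / w.[a]) *: (\prod_(x <- rs') ('X - x%:P) * w) + b0).
  exact: subalgL.
have -> : p - (r.[a] / w.[a] *: (\prod_(x <- rs') ('X - x%:P) * w) + b0) =
    (r - (r.[a] / w.[a]) *: w) * \prod_(x <- rs') ('X - x%:P).
  by rewrite opprD addrCA er mulrBl addrC -scalerAl [w * _]mulrC.
rewrite big_cons; apply: dvdp_mul => //.
by rewrite dvdp_XsubCl rootE !hornerE mulfVK // subrr.
Qed.

(** The digits of [r] in base [h]: they exhibit $k[X]$ as finitely generated over $k[h]$. *)
Lemma base_expansion (h : {poly k}) : (1 < size h)%N -> forall r,
  exists C : 'I_(size h).-1 -> {poly k}, r = \sum_j (C j \Po h) * 'X^j.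
Proof.
move=> sh r; have [m] := ubnP (size r); elim: m r => [|m IH] r //.
rewrite ltnS => hr.
have h0 : h != 0 by rewrite -size_poly_gt0; apply: leq_trans sh.
have [r0|r0] := eqVneq r 0.
  by exists (fun _ => 0); rewrite r0 big1 // => j _; rewrite comp_poly0 mul0r.
have sdiv : (size (r %/ h)%R < m)%N.
  apply: leq_trans hr; rewrite size_divp //.
  by rewrite ltn_subrL size_poly_gt0 r0 andbT -subn1 subn_gt0.
have [C eC] := IH _ sdiv.
exists (fun j => C j * 'X + ((r %% h)`_j)%:P).
rewrite {1}(divp_eq r h) {1}eC mulr_suml.
have em : r %% h = \sum_(j < (size h).-1) (r %% h)`_j *: 'X^j.
  rewrite -poly_def; apply/polyP=> i; rewrite coef_poly; case: ltnP => // hi.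
  rewrite nth_default //; apply: leq_trans hi.
  by have := ltn_modpN0 r h0; case: (size h) sh => // a _; rewrite ltnS.
rewrite [X in _ + X]em -big_split /=; apply: eq_bigr => j _.
rewrite comp_polyD comp_polyM comp_polyX comp_polyC -mul_polyC; ring.
Qed.

(* Nakayama: [k[X] = B + h k[X]] is finite over [k[h]], hence an element of
   [1 + h k[h]] annihilates [k[X] / B]. *)
Lemma conductor (h : {poly k}) : (1 < size h)%N -> B h ->
  (forall p, exists2 b, B b & h %| p - b) ->
  exists2 q, q != 0 & forall r, B (q * r).
Proof.
move=> sh Bh surj; set N := (size h).-1.
have row i : exists C : 'I_N -> {poly k},
    B ('X^i - h * \sum_j (C j \Po h) * 'X^j).
  have [b hb /dvdpP [r er]] := surj 'X^i; have [C eC] := base_expansion sh r.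
  by exists C; rewrite -eC mulrC -er opprB addrC subrK.
have [C hC] := ClassicalEpsilon.choice _ row.
(* The variable stands for [h]: after substitution, [A] sends the vector of powers $X^j$ into [B],
   and so does its determinant times each power, by the adjugate. At $0$ the matrix is the identity,
   so the determinant composed with [h] is $1$ at a root of [h]. *)
pose A : 'M[{poly k}]_N := 1%:M - 'X *: \matrix_(i, j) C i j.
have [x0 hx0] := closed_root sh.
have dA0 : (\det A).[0] = 1.
  rewrite -horner_evalE -det_map_mx -[RHS](det1 k N); congr (\det _).
  apply/matrixP=> i j; rewrite !mxE /= /horner_eval !hornerE.
  by rewrite -(rmorph_nat (@polyC k)) hornerC subr0.
exists (\det A \Po h).
  apply/negP=> /eqP e; have : (\det A \Po h).[x0] = 0 by rewrite e horner0.
  by rewrite horner_comp (rootP hx0) dA0 => /eqP; rewrite oner_eq0.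
pose bb (i : 'I_N) := \sum_j (A i j \Po h) * 'X^j.
have Bb i : B (bb i).
  have -> : bb i = 'X^i - h * \sum_j (C i j \Po h) * 'X^j; last exact: hC.
  rewrite /bb mulr_sumr -sumrN.
  rewrite (eq_bigr (fun j : 'I_N => (if i == j then 'X^j else 0) + - (h * ((C i j \Po h) * 'X^j)))).
    by rewrite big_split /= -big_mkcond /= (big_pred1 i) // => j; rewrite eq_sym.
  move=> j _; rewrite !mxE comp_polyB comp_polyM comp_polyX.
  by case: (i == j); rewrite ?mulr1n ?mulr0n ?comp_polyC ?comp_poly0; ring.
have BX (j : 'I_N) : B ((\det A \Po h) * 'X^j).
  have -> : (\det A \Po h) * 'X^j = \sum_i ((\adj A) j i \Po h) * bb i.
    rewrite /bb; under [RHS]eq_bigr do rewrite mulr_sumr.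
    rewrite exchange_big /= (bigD1 j) //= [X in _ + X]big1 ?addr0.
      under eq_bigr do rewrite mulrA -comp_polyM.
      rewrite -mulr_suml -(raddf_sum (comp_poly h)).
      have := congr1 (fun M : 'M_N => M j j) (mul_adj_mx A).
      by rewrite !mxE eqxx mulr1n => <-.
    move=> l lj; under eq_bigr do rewrite mulrA -comp_polyM.
    rewrite -mulr_suml -(raddf_sum (comp_poly h)).
    have := congr1 (fun M : 'M_N => M j l) (mul_adj_mx A).
    by rewrite !mxE eq_sym (negPf lj) mulr0n => ->; rewrite raddf0 mul0r.
  by apply: subalg_sum => i; apply: subalgM => //; apply: subalg_comp.
move=> r; have [R ->] := base_expansion sh r; rewrite mulr_sumr.
apply: subalg_sum => j; rewrite mulrCA; apply: subalgM => //.
exact: subalg_comp.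
Qed.

End Subalgebra.
End Univariate.

(** * General position *)

Section GeneralPosition.
Variables (k : closedFieldType) (hchar : [pchar k] =i pred0).
Implicit Types (p q r b z h f g : {poly k}) (s t c : k).

Lemma natr_neq0 n : (0 < n)%N -> n%:R != 0 :> k.
Proof. by move=> n0; rewrite ((pcharf0P k).1 hchar) -lt0n. Qed.

Lemma common_nonroot (I : eqType) (P : I -> {poly k}) (l : seq I) :
  (forall x, x \in l -> P x != 0) -> exists c, forall x, x \in l -> ~~ root (P x) c.
Proof.
move=> h; have [|c hc] := @exists_nonroot k (\prod_(x <- l) P x).
  by rewrite prodf_seq_neq0; apply/allP.
exists c => x hx; apply: contra hc => hr.
by rewrite (big_rem x) //= rootM hr.
Qed.

(** Each condition is polynomial along lines in the space [V]. On the line through a solution of the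
    earlier conditions and a solution of the new one, no condition vanishes identically, and [k] is
    infinite. *)
Lemma generic_choice (I : eqType) (V : {poly k} -> Prop) (F : I -> {poly k} -> k)
    (l : seq I) :
  (exists p, V p) -> (forall c p q, V p -> V q -> V (c *: p + q)) ->
  (forall x p q, exists P, forall c, F x (c *: q + p) = P.[c]) ->
  (forall x, x \in l -> exists2 p, V p & F x p != 0) ->
  exists2 p, V p & forall x, x \in l -> F x p != 0.
Proof.
move=> [v0 hv0] hV hF; elim: l => [|x l IH] hl; first by exists v0.
have [p0 hp0 hpl] := IH (fun y hy => hl y (mem_behead (s := x :: l) hy)).
have [p1 hp1 hpx] := hl x (mem_head _ _).
have [Q hQ] := choice _ (fun y => hF y p0 (p1 - p0)).
have [|c hc] := @common_nonroot _ Q (x :: l).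
  move=> y; rewrite inE => /orP [/eqP ->|hy].
    by apply: contraNneq hpx => e; rewrite -[p1](subrK p0) -(scale1r (p1 - p0)) hQ e horner0.
  by apply: contraNneq (hpl y hy) => e; rewrite -[p0]add0r -(scale0r (p1 - p0)) hQ e horner0.
exists (c *: (p1 - p0) + p0); last by move=> y /hc; rewrite hQ rootE.
by apply: (hV _ _ _ _ hp0); rewrite addrC -scaleN1r; apply: hV.
Qed.

Variables (d : nat) (hd : (1 < d)%N).

Lemma divdiff_pow_line s t p q c : divdiff s t ((c *: q + p) ^+ d) =
  (\sum_(j < d.+1) (divdiff s t (p ^+ (d - j) * q ^+ j) *+ 'C(d, j)) *: 'X^j).[c].
Proof.
rewrite addrC exprDn divdiff_sum horner_sum; apply: eq_bigr => j _.
rewrite hornerZ hornerXn exprZn -scalerAr -scaler_nat !divdiffZ -mulr_natl; ring.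
Qed.

Lemma divdiff_pow_line_poly s t p q :
  exists P : {poly k}, forall c, divdiff s t ((c *: q + p) ^+ d) = P.[c].
Proof. by eexists=> c; apply: divdiff_pow_line. Qed.

(** Characteristic zero is used here: the coefficient of $c^j$ carries the factor $\binom dj$. *)
Lemma divdiff_pow_line_coef s t p q :
  (forall c, divdiff s t ((c *: q + p) ^+ d) = 0) ->
  forall j, (j <= d)%N -> divdiff s t (p ^+ (d - j) * q ^+ j) = 0.
Proof.
move=> h j hj; apply/eqP; have := natr_neq0 (n := 'C(d, j)).
rewrite bin_gt0 hj => /(_ isT) hb.
have : (\sum_(i < d.+1) (divdiff s t (p ^+ (d - i) * q ^+ i) *+ 'C(d, i)) *: 'X^i)`_j = 0.
  rewrite (_ : \sum_(i < _) _ = 0) ?coef0 //; apply: poly_fun_inj => c.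
  by rewrite horner0 -divdiff_pow_line h.
rewrite -(poly_def d.+1 (fun i => divdiff s t (p ^+ (d - i) * q ^+ i) *+ 'C(d, i))).
rewrite coef_poly ltnS hj -mulr_natl => /eqP.
by rewrite mulf_eq0 (negPf hb).
Qed.

(** The pairs $s=t$ are included, and $d>1$; hence [h] vanishes at no root of [z], so that this one
    condition also takes care of common zeros. *)
Definition pow_separates h z := forall s t, root z s -> root z t ->
  divdiff s t (h ^+ d) != 0.

Lemma dvdp_root p q s : p %| q -> root p s -> root q s.
Proof. by rewrite -!dvdp_XsubCl => pq sp; apply: dvdp_trans pq. Qed.

Lemma pow_separates_dvd h z z' : z' %| z -> pow_separates h z -> pow_separates h z'.
Proof. by move=> hz H s t hs ht; apply: H; apply: (dvdp_root hz). Qed.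

Lemma pow_separates_nonroot h z s : pow_separates h z -> root z s -> h.[s] != 0.
Proof.
move=> H hs; apply: contraNneq (H s s hs hs) => h0.
have -> : d = d.-2.+1.+1 by case: (d) hd => // -[].
by rewrite exprS divdiffM !hornerE h0 exprS !mul0r mulr0 addr0.
Qed.

Lemma pow_separates_size h z s : pow_separates h z -> root z s -> (1 < size h)%N.
Proof.
move=> H hs; rewrite ltnNge; apply/negP => /size1_polyC e.
by have := H s s hs hs; rewrite e -polyC_exp divdiffC eqxx.
Qed.

(** A generic translate $X+c$ works: in the divided difference of $(X+c)^d$ the coefficient of
    $c^{d-1}$ is $d$, for all $s$ and $t$. *)
Lemma pow_separates_exists z : z != 0 -> exists2 h : {poly k}, (1 < size h)%N & pow_separates h z.
Proof.
move=> z0; have [rs zE] := closed_field_poly_normal z.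
have lz : lead_coef z != 0 by rewrite lead_coef_eq0.
pose F (x : k * k) p := divdiff x.1 x.2 (('X + p) ^+ d).
have [||x p q|x hx|p [c ->] hp] := @generic_choice _ (fun p => exists c, p = c%:P) F
  [seq (s, t) | s <- rs, t <- rs].
- by exists 0; exists 0.
- by move=> c _ _ [c1 ->] [c2 ->]; exists (c * c1 + c2); rewrite -mul_polyC -polyCM -polyCD.
- have [P hP] := divdiff_pow_line_poly x.1 x.2 ('X + p) q.
  by exists P => c; rewrite -hP /F addrCA.
- apply: NNPP => hn; have /(@divdiff_pow_line_coef x.1 x.2 'X 1) : forall c,
      divdiff x.1 x.2 ((c *: 1 + 'X) ^+ d) = 0.
    move=> c; apply/eqP/negPn/negP => hc; apply: hn; exists c%:P; first by exists c.
    by rewrite /F addrC -[c%:P]mulr1 mul_polyC.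
  move=> /(_ d.-1 (leq_pred _)); have -> : (d - d.-1 = 1)%N by case: (d) hd => // d' _; rewrite subSnn.
  by rewrite expr1 expr1n mulr1 divdiffX => /eqP; rewrite oner_eq0.
exists ('X + c%:P); first by rewrite size_XaddC.
move=> s t; rewrite zE !rootZ // !root_prod_XsubC => hs ht.
by apply: (hp (s, t)); apply/allpairsP; exists (s, t).
Qed.

(** Here $q^d$ is the element [h] of [conductor]: it lies in [B], and at its roots, which are those
    of [q], the element $p^d$ separates. *)
Lemma pow_separates_conductor (B : {poly k} -> Prop) p q : subalgebra B ->
  B (p ^+ d) -> B (q ^+ d) -> (1 < size q)%N -> pow_separates p q ->
  exists2 z, z != 0 & forall r, B (z * r).
Proof.
move=> hB Bp Bq sq hpq; have d0 : (0 < d)%N by apply: ltnW.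
have q0 : q != 0 by rewrite -size_poly_gt0; apply: ltnW.
apply: (conductor hB (h := q ^+ d)) => //.
  by rewrite -subn_gt0 subn1 size_exp muln_gt0 d0 -subn1 subn_gt0 sq.
apply: separates_surj_mod => //; first by rewrite expf_neq0.
move=> s t; rewrite !rootE !horner_exp !expf_eq0 d0 /= => hs ht.
by exists (p ^+ d) => //; apply: hpq.
Qed.

Lemma pow_separates_full (B : {poly k} -> Prop) p z : subalgebra B ->
  B (p ^+ d) -> z != 0 -> (forall r, B (z * r)) -> pow_separates p z -> forall r, B r.
Proof.
move=> hB Bp z0 hz hpz r.
have [s t hs ht|b hb /dvdpP [u e]] := @separates_surj_mod k B hB z z0 _ r.
  by exists (p ^+ d) => //; apply: hpz.
by rewrite -(subrK b r) e mulrC; apply: (subalgD hB).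
Qed.

(* [B] and [V] play the roles of the invariants and of a module of
   semi-invariants that may be added to [f].  The idea is to expand
   [(f + c q)^d] in [c] and to look at the coefficients of [c^d] and [c^(d-1)]. *)
Lemma pow_separates_shift (B V : {poly k} -> Prop) f s t :
  subalgebra B -> (forall c p q, V p -> V q -> V (c *: p + q)) ->
  (forall b p, B b -> V p -> V (b * p)) -> (forall p, V p -> B (p ^+ d)) ->
  (forall u, exists2 q, V q & q.[u] != 0) ->
  ((forall b, B b -> divdiff s t b = 0) -> forall c q, V q ->
     ('X - s%:P) * ('X - t%:P) %| f - c *: q -> False) ->
  exists2 p, V p & divdiff s t ((f + p) ^+ d) != 0.
Proof.
move=> hB hV hBV hVd hq hsep.
have d1 : (d - d.-1 = 1)%N by case: (d) hd => // d' _; rewrite subSnn.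
have dE : d = d.-1.+1 by case: (d) hd.
have hV0 : forall p, V p -> V 0.
  by move=> p hp; have := hV (-1) _ _ hp hp; rewrite scaleN1r addNr.
have hVZ c p : V p -> V (c *: p).
  by move=> hp; rewrite -[_ *: _]addr0; apply: hV => //; apply: hV0 hp.
have [q Vq [qs qt]] : exists2 q, V q & q.[s] != 0 /\ q.[t] != 0.
  have [q1 V1 h1] := hq s; have [q2 V2 h2] := hq t.
  have [e1|] := eqVneq q1.[t] 0; last by exists q1.
  have [e2|] := eqVneq q2.[s] 0; last by exists q2.
  exists (1 *: q1 + q2); first exact: hV.
  by rewrite !hornerE e1 e2 addr0 add0r.
(* If [b] separates, then $q^d$ and $(bq)q^{d-1}=bq^d$ cannot both have divided difference zero, so
   some $q'$ in [V] has a separating power $q'^d$; this is the coefficient of $c^d$ in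
   $(f+cq')^d$. *)
have [[b Bb hb]|hn] := classic (exists2 b, B b & divdiff s t b != 0).
  have [q' Vq' hq'] : exists2 q', V q' & divdiff s t (q' ^+ d) != 0.
    apply: NNPP => hn; have /(@divdiff_pow_line_coef s t (b * q) q) H : forall c,
        divdiff s t ((c *: q + b * q) ^+ d) = 0.
      move=> c; apply/eqP/negPn/negP => hc; apply: hn; exists (c *: q + b * q) => //.
      by apply: hV => //; apply: hBV.
    have := H _ (leq_pred d); have := H _ (leqnn d).
    rewrite subnn expr0 mul1r d1 expr1 -mulrA -exprS -dE divdiffM => ->.
    rewrite mulr0 addr0 => /eqP; rewrite mulf_eq0 (negPf hb) horner_exp expf_eq0 (negPf qt) andbF.
    by [].
  apply: NNPP => hn; have /(@divdiff_pow_line_coef s t f q') H : forall c,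
      divdiff s t ((c *: q' + f) ^+ d) = 0.
    move=> c; apply/eqP/negPn/negP => hc; apply: hn; exists (c *: q'); first exact: hVZ.
    by rewrite addrC.
  by move: hq'; have := H _ (leqnn d); rewrite subnn expr0 mul1r => ->; rewrite eqxx.
(* If no element of [B] separates, then modulo $(X-s)(X-t)$ both $q^d$ and, by the coefficient of
   $c^{d-1}$, $fq^{d-1}$ are constants $\nu\neq0$ and $\mu$. So $f$ is congruent to $(\mu/\nu)q$,
   which [hsep] excludes. *)
have {}hn b : B b -> divdiff s t b = 0.
  by move=> Bb; apply/eqP/negPn/negP => hb; apply: hn; exists b.
apply: NNPP => hn'; have /(@divdiff_pow_line_coef s t f q) H : forall c,
    divdiff s t ((c *: q + f) ^+ d) = 0.
  move=> c; apply/eqP/negPn/negP => hc; apply: hn'; exists (c *: q); first exact: hVZ.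
  by rewrite addrC.
have /eqP/divdiff0P [mu hmu] := H _ (leq_pred d).
have /eqP/divdiff0P [nu hnu] := hn _ (hVd _ Vq).
have nu0 : nu != 0.
  have : root (q ^+ d - nu%:P) s.
    by apply: (dvdp_root hnu); rewrite rootM root_XsubC eqxx.
  by rewrite rootE !hornerE subr_eq0 => /eqP <-; rewrite expf_neq0.
apply: (hsep hn (mu / nu) q Vq).
rewrite -(dvdpZr _ _ nu0) scalerBr scalerA mulrCA mulfV // mulr1.
have -> : nu *: f - mu *: q = (f ^+ (d - d.-1) * q ^+ d.-1 - mu%:P) * q - f * (q ^+ d - nu%:P).
  by rewrite d1 expr1 {2}dE exprS -!mul_polyC; ring.
by apply: dvdp_sub; [apply: dvdp_mulr|apply: dvdp_mull].
Qed.

(** A generic member of [V] avoids the finitely many roots of a fixed one, and Bezout's identity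
    applies: the weak Nullstellensatz in one variable. *)
Lemma ideal_full (V : {poly k} -> Prop) :
  (forall p q, V p -> V q -> V (p + q)) -> (forall r p, V p -> V (r * p)) ->
  (forall u, exists2 q, V q & q.[u] != 0) -> forall r, V r.
Proof.
move=> hD hM hq r; have [q0 Vq0 h0] := hq 0.
have q00 : q0 != 0 by apply: contraNneq h0 => ->; rewrite horner0.
have [rs qE] := closed_field_poly_normal q0.
have [||x p q|x hx|p Vp hp] := @generic_choice _ V (fun u p => p.[u]) rs.
- by exists q0.
- by move=> c p q Vp Vq; rewrite -mul_polyC; apply: hD => //; apply: hM.
- by exists (q.[x] *: 'X + p.[x]%:P) => c; rewrite !hornerE mulrC.
- exact: hq.
have /Bezout_coprimepP [[u v] /= /eqpP [[a b] /= /andP [a0 b0] e]] : coprimep q0 p.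
  rewrite coprimep_def /coprimep; apply/negPn/negP => hn.
  have g0 : gcdp q0 p != 0 by rewrite gcdp_eq0 (negPf q00).
  have [|x] := @closed_root k (gcdp q0 p).
    by rewrite ltn_neqAle eq_sym hn size_poly_gt0.
  rewrite root_gcd => /andP [hx]; apply/negP; apply: hp.
  by move: hx; rewrite qE rootZ ?lead_coef_eq0 // root_prod_XsubC.
have -> : r = r * (a / b)%:P * (u * q0 + v * p).
  rewrite -mulrA mul_polyC [a / b]mulrC -scalerA e scalerA mulVf // scale1r mulr1 //.
by apply: (hM); apply: hD; apply: hM.
Qed.

Lemma monic_nth_root g e : (0 < e)%N -> g != 0 -> (forall u, e %| mup u g)%N ->
  exists2 h, h \is monic & g = lead_coef g *: h ^+ e.
Proof.
move=> e0; have [m] := ubnP (size g); elim: m g => // m IH g; rewrite ltnS => hm g0 hu.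
have [sg|sg] := leqP (size g) 1.
  exists 1; rewrite ?monic1 // expr1n; rewrite {1}(size1_polyC sg) -mul_polyC mulr1.
  by rewrite {2}(size1_polyC sg) lead_coefC.
have [u ru] := closed_root sg.
have m0 : (0 < mup u g)%N by rewrite -XsubC_dvd // dvdp_XsubCl.
have : (e <= mup u g)%N by apply: dvdn_leq.
rewrite mup_geq // => /dvdpP [g' eg].
have g'0 : g' != 0 by apply: contraNneq g0 => e'; rewrite eg e' mul0r.
have x0 : ('X - u%:P) ^+ e != 0 by rewrite expf_neq0 // polyXsubC_eq0.
have [||h hm' eh] := IH g' _ g'0.
- apply: leq_trans hm; rewrite eg size_mul // size_exp_XsubC addnS /=.
  by rewrite -{1}(addn0 (size g')) ltn_add2l.
- move=> w; have := hu w; rewrite eg mupM // mup_XsubCX.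
  by case: (u == w); rewrite ?addn0 // dvdn_addl.
exists (h * ('X - u%:P)); first by rewrite monicMl // monicXsubC.
have -> : lead_coef g = lead_coef g'.
  by rewrite eg lead_coefM lead_coef_exp lead_coefXsubC expr1n mulr1.
by rewrite eg {1}eh exprMn scalerAl.
Qed.

Lemma monic_exp_inj p q c e : (0 < e)%N -> q \is monic -> p ^+ e = c *: q ^+ e ->
  p = lead_coef p *: q.
Proof.
move=> e0 mq E; have [->|p0] := eqVneq p 0; first by rewrite lead_coef0 scale0r.
have c0 : c != 0.
  by apply: contraNneq p0 => c0; move: E; rewrite c0 scale0r => /eqP; rewrite expf_eq0 e0.
have : p %= q.
  by rewrite /eqp -(dvdp_pexp2r p q e0) -(dvdp_pexp2r q p e0) E dvdpZl // dvdpZr // dvdpp.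
by move=> /eqp_eq; rewrite (monicP mq) scale1r.
Qed.

End GeneralPosition.

(** * Coordinates of the character lattice *)

Lemma ex_min_nat (P : nat -> Prop) : (exists e, P e) ->
  exists2 e, P e & forall e', P e' -> (e <= e')%N.
Proof.
move=> [e]; have [m] := ubnP e; elim: m e => // m IH e; rewrite ltnS => hm he.
have [[e' [lt he']]|hn] := classic (exists e', (e' < e)%N /\ P e').
  by apply: (IH e') => //; apply: leq_trans hm.
exists e => // e' he'; rewrite leqNgt; apply/negP => lt; apply: hn.
by exists e'.
Qed.

Section Pairing.
Variable n : nat.
Implicit Types m w : 'rV[int]_n.

Lemma pairingD m m' w : pairing (m + m') w = pairing m w + pairing m' w.
Proof. by rewrite -big_split; apply: eq_bigr => j _; rewrite mxE mulrDl. Qed.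

Lemma pairingZ (c : int) m w : pairing (c *: m) w = c * pairing m w.
Proof. by rewrite mulr_sumr; apply: eq_bigr => j _; rewrite mxE mulrA. Qed.

End Pairing.

(* [a m i] is the pairing of [m] with the primitive vector on the ray of [v i];
   the image of [a] is a sublattice of [Z^n] containing [d Z^n]. *)
Record coordinates n (v : 'I_n -> 'rV[int]_n) (d : nat)
    (a : 'rV[int]_n -> 'I_n -> int) (dl : 'I_n -> 'rV[int]_n) : Prop := Coordinates {
  coordD : forall m m' i, a (m + m') i = a m i + a m' i;
  coord_dl : forall i j, a (dl i) j = d%:Z *+ (i == j);
  coord_prim : forall i, exists m, a m i = 1;
  coord_dual : forall m, inDual v m <-> forall i, 0 <= a m i;
  coord_inj : forall m, (forall i, a m i = 0) -> m = 0;
  coord_gt1 : (1 < d)%N }.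

Lemma simplicial_coordinates n (v : 'I_n -> 'rV[int]_n) : simplicial_full v ->
  exists d a dl, coordinates v d a dl.
Proof.
move=> hs; pose M : 'M[int]_n := \matrix_(i, j) v i ord0 j; pose D := \det M.
have D0 : D != 0.
  rewrite -(intr_eq0 rat) -det_map_mx; apply: contraNneq hs => <-; apply/eqP.
  by congr (\det _); apply/matrixP => i j; rewrite !mxE.
pose mi (i : 'I_n) : 'rV[int]_n := \row_j (\adj M) j i.
have pmi i l : pairing (mi i) (v l) = D *+ (l == i).
  have := congr1 (fun A : 'M_n => A l i) (mul_mx_adj M); rewrite !mxE => <-.
  by apply: eq_bigr => j _; rewrite !mxE mulrC.
(* The positive generator of the ideal of values on [v i]; dividing by it amounts to replacing [v i]
   by the primitive vector of its ray. *)
have hc i : exists c : nat, [/\ (0 < c)%N, exists m, pairing m (v i) = c%:Z &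
    forall m, (c%:Z %| pairing m (v i))%Z].
  have [|c [c0 [m0 hm0]] cmin] := @ex_min_nat
      (fun c => (0 < c)%N /\ exists m, pairing m (v i) = c%:Z).
    exists `|D|%N; split; first by rewrite absz_gt0.
    by exists (Num.sg D *: mi i); rewrite pairingZ pmi eqxx mulr1n abszE normrEsg.
  exists c; split=> //; first by exists m0.
  move=> m; apply/dvdz_mod0P; apply/eqP/negPn/negP => hn.
  have cz : 0 < c%:Z by rewrite ltz_nat.
  have r0 : 0 <= (pairing m (v i) %% c)%Z by apply: modz_ge0; rewrite gt_eqF.
  have rc : (pairing m (v i) %% c)%Z < c%:Z by apply: ltz_pmod.
  have /cmin : (0 < `|(pairing m (v i) %% c)%Z|)%N /\
      exists m', pairing m' (v i) = `|(pairing m (v i) %% c)%Z|%N%:Z.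
    split; first by rewrite absz_gt0.
    exists (m + (- (pairing m (v i) %/ c)%Z) *: m0).
    rewrite pairingD pairingZ hm0 (gez0_abs r0) mulNr.
    by rewrite {1}(divz_eq (pairing m (v i)) c) addrAC subrr add0r.
  by rewrite -lez_nat (gez0_abs r0) leNgt rc.
have [c hc'] := choice _ hc.
have c0 i : 0 < (c i)%:Z by rewrite ltz_nat; case: (hc' i).
have cp i : exists m, pairing m (v i) = (c i)%:Z by case: (hc' i).
have cd i m : ((c i)%:Z %| pairing m (v i))%Z by case: (hc' i).
pose a m i := (pairing m (v i) %/ (c i)%:Z)%Z.
have aE m i : pairing m (v i) = a m i * (c i)%:Z by rewrite divzK.
have aI m i z : pairing m (v i) = z * (c i)%:Z -> a m i = z.
  by move=> e; rewrite /a e mulzK // gt_eqF.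
(* The columns of the adjugate are dual to the rays up to the factor [D]. The sign makes the
   multiple positive, and the factor $2$ ensures $1<d$ even when $|D|=1$. *)
exists (2 * `|D|)%N, a, (fun i => (2 * Num.sg D * (c i)%:Z) *: mi i); split.
- by move=> m m' i; apply: aI; rewrite pairingD !aE mulrDl.
- move=> i j; apply: aI; rewrite pairingZ pmi eq_sym.
  case: eqP => [->|_]; last by rewrite !mulr0n mulr0 mul0r.
  by rewrite !mulr1n PoszM abszE normrEsg; ring.
- by move=> i; have [m hm] := cp i; exists m; apply: aI; rewrite mul1r.
- move=> m; split=> h i; have := h i; first by rewrite aE pmulr_lge0.
  by rewrite aE pmulr_lge0.
- move=> m h; have hM : M *m m^T = 0.
    apply/matrixP => i j; rewrite !mxE.
    transitivity (pairing m (v i)); last by rewrite aE h mul0r.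
    by apply: eq_bigr => l _; rewrite !mxE mulrC !ord1.
  have := mulmxA (\adj M) M m^T; rewrite hM mulmx0 mul_adj_mx mul_scalar_mx.
  move=> e; apply/matrixP => i j; have := congr1 (fun A : 'cV_n => A j i) e.
  by rewrite !mxE => /esym/eqP; rewrite mulf_eq0 (negPf D0) /= => /eqP.
- by have := D0; rewrite -absz_gt0; case: `|D|%N => // e _; rewrite mul2n doubleS.
Qed.

(** * Points of the toric variety in homogeneous coordinates *)

Section Points.
Variables (k : closedFieldType) (n : nat) (v : 'I_n -> 'rV[int]_n) (d : nat)
  (a : 'rV[int]_n -> 'I_n -> int) (dl : 'I_n -> 'rV[int]_n).
Hypothesis hc : coordinates v d a dl.
Implicit Types (m : 'rV[int]_n) (y : 'I_n -> k) (x : Pt k n).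

Let aD := coordD hc.

Lemma coord_gt0 : (0 < d)%N. Proof. exact: ltnW (coord_gt1 hc). Qed.

Lemma coord0 i : a 0 i = 0.
Proof. by apply: (addrI (a 0 i)); rewrite -aD !addr0. Qed.

Lemma coordN m i : a (- m) i = - a m i.
Proof. by apply: (addrI (a m i)); rewrite -aD !subrr coord0. Qed.

Lemma coordMn m e i : a (m *+ e) i = a m i *+ e.
Proof. by elim: e => [|e IH]; rewrite ?mulr0n ?coord0 // !mulrS aD IH. Qed.

Lemma coord_sum (I : Type) (r : seq I) (F : I -> 'rV[int]_n) i :
  a (\sum_(j <- r) F j) i = \sum_(j <- r) a (F j) i.
Proof.
by elim: r => [|j r IH]; rewrite ?big_nil ?coord0 // !big_cons aD IH.
Qed.

Lemma coord_ext m m' : (forall i, a m i = a m' i) -> m = m'.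
Proof.
move=> h; apply/eqP; rewrite -subr_eq0; apply/eqP; apply: (coord_inj hc) => i.
by rewrite aD coordN h subrr.
Qed.

Definition dl_comb (w : 'I_n -> nat) := \sum_l dl l *+ w l.

Lemma coord_comb w i : a (dl_comb w) i = (d * w i)%:Z.
Proof.
rewrite coord_sum (bigD1 i) //= big1 ?addr0 => [|j ji]; rewrite coordMn (coord_dl hc).
  by rewrite eqxx mulr1n -mulr_natr natz PoszM.
by rewrite (negPf ji) mulr0n mul0rn.
Qed.

Lemma dual_comb w : inDual v (dl_comb w).
Proof. by apply/(coord_dual hc) => i; rewrite coord_comb. Qed.

Lemma dual_dl i : inDual v (dl i).
Proof. by apply/(coord_dual hc) => j; rewrite (coord_dl hc) mulrn_wge0. Qed.

Lemma dual0 : inDual v 0.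
Proof. by apply/(coord_dual hc) => i; rewrite coord0. Qed.

Lemma dualD m m' : inDual v m -> inDual v m' -> inDual v (m + m').
Proof.
by move=> /(coord_dual hc) h /(coord_dual hc) h'; apply/(coord_dual hc) => i; rewrite aD addr_ge0.
Qed.

(** Multiples of the [dl i] with [i] outside [Z] raise the other coordinates and leave those in [Z]
    alone. *)
Lemma dual_shift (Z : pred 'I_n) m : (forall j, Z j -> 0 <= a m j) ->
  exists2 m', inDual v m' & forall j, Z j -> a m' j = a m j.
Proof.
move=> h; exists (m + dl_comb (fun i => if Z i then 0 else `|a m i|)%N); last first.
  by move=> j hj; rewrite aD coord_comb hj muln0 addr0.
apply/(coord_dual hc) => i; rewrite aD coord_comb; case: ifP => hi.
  by rewrite muln0 addr0 h.
have := coord_gt0; case: (d) => // d' _; rewrite mulSn PoszD addrA addr_ge0 //.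
by rewrite abszE addrC -lerBlDr sub0r -normrN ler_norm.
Qed.

Definition degs m i : nat := `|a m i|%N.

Lemma degsE m i : inDual v m -> (degs m i)%:Z = a m i.
Proof. by move=> /(coord_dual hc) h; rewrite gez0_abs. Qed.

Lemma degsD m m' i : inDual v m -> inDual v m' -> degs (m + m') i = (degs m i + degs m' i)%N.
Proof.
move=> h h'; apply/eqP; rewrite -eqz_nat PoszD !degsE ?aD //; exact: dualD.
Qed.

Definition dualb m := [forall i, 0 <= a m i].

Lemma dualP m : reflect (inDual v m) (dualb m).
Proof.
apply: (iffP forallP) => [h|h i]; first exact/(coord_dual hc).
by move/(coord_dual hc): h.
Qed.

Definition mon (al : 'I_n -> nat) y : k := \prod_i y i ^+ al i.

Lemma monD al al' y : mon (fun i => al i + al' i)%N y = mon al y * mon al' y.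
Proof. by rewrite -big_split; apply: eq_bigr => i _; rewrite exprD. Qed.

Lemma mon_eq0 al y : (mon al y == 0) = [exists i, (y i == 0) && (0 < al i)%N].
Proof.
apply/eqP/existsP => [/eqP|[i /andP [/eqP h hi]]].
  rewrite prodf_seq_eq0 => /hasP [i _] /=; rewrite expf_eq0 andbC => h.
  by exists i.
by rewrite /mon (bigD1 i) //= h expr0n gtn_eqF // mul0r.
Qed.

(** The quotient map $\mathbb A^n\to X_\sigma$ on points: the character [m] pulls back to the
    monomial with exponents [a m]. *)
Definition pt y : Pt k n := fun m => if dualb m then mon (degs m) y else 0.

Lemma ptE y m : inDual v m -> pt y m = mon (degs m) y.
Proof. by move=> /dualP h; rewrite /pt h. Qed.

Lemma pt_isPoint y : isPoint v (pt y).
Proof.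
split=> [|m m' h h'|m /dualP /negPf h]; last by rewrite /pt h.
  rewrite ptE; last exact: dual0.
  by rewrite /mon big1 // => i _; rewrite /degs coord0 expr0.
rewrite !ptE //; last exact: dualD.
by rewrite -monD; apply: eq_bigr => i _; rewrite degsD.
Qed.

Lemma pt_dl y i : pt y (dl i) = y i ^+ d.
Proof.
rewrite ptE; last exact: dual_dl.
rewrite /mon (bigD1 i) //= big1 ?mulr1 => [|j ji]; rewrite /degs (coord_dl hc).
  by rewrite eqxx mulr1n absz_nat.
by rewrite eq_sym (negPf ji) mulr0n expr0.
Qed.

Lemma point_comb x w : isPoint v x -> x (dl_comb w) = \prod_i x (dl i) ^+ w i.
Proof.
move=> [x1 xM _].
have dMn m e : inDual v m -> inDual v (m *+ e).
  by move=> h; elim: e => [|e IH]; [exact: dual0|rewrite mulrS; apply: dualD].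
have xMn m e : inDual v m -> x (m *+ e) = x m ^+ e.
  move=> h; elim: e => [|e IH]; first by rewrite mulr0n x1.
  by rewrite mulrS xM ?IH ?exprS //; apply: dMn.
rewrite /dl_comb; suff : inDual v (\sum_l dl l *+ w l) /\
    x (\sum_l dl l *+ w l) = \prod_i x (dl i) ^+ w i by case.
elim/big_rec2: _ => [|i p q _ [hm hp]]; first by split; [exact: dual0|].
have hi := dMn _ (w i) (dual_dl i).
by split; [apply: dualD|rewrite xM // hp xMn //; exact: dual_dl].
Qed.

Lemma dual_mulrn m : inDual v m -> m *+ d = dl_comb (degs m).
Proof.
move=> h; apply: coord_ext => i; rewrite coordMn coord_comb PoszM degsE //.
by rewrite -mulr_natr natz mulrC.
Qed.

Lemma point_exp x m : isPoint v x -> inDual v m ->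
  x m ^+ d = \prod_i x (dl i) ^+ degs m i.
Proof.
move=> hx h; rewrite -point_comb // -dual_mulrn //; case: hx => x1 xM _.
suff : inDual v (m *+ d) /\ x (m *+ d) = x m ^+ d by case.
elim: d => [|e [IH1 IH2]]; first by split; [exact: dual0|].
by rewrite mulrS exprS xM // IH2; split=> //; apply: dualD.
Qed.

(* [k^*] is divisible, hence characters of a subgroup of [Z^n] extend to [Z^n]. *)
Lemma character_extension (U : 'rV[int]_n -> Prop) (psi : 'rV[int]_n -> k) :
  U 0 -> (forall m m', U m -> U m' -> U (m + m')) -> (forall m, U m -> U (- m)) ->
  (forall m, U m -> psi m != 0) ->
  (forall m m', U m -> U m' -> psi (m + m') = psi m * psi m') ->
  exists2 y, (forall i, y i != 0) & forall m, U m -> psi m = \prod_i y i ^ a m i.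
Proof.
move=> U0 UD UN psi0 psiM.
have psi1 : psi 0 = 1.
  by apply: (mulfI (psi0 _ U0)); rewrite -psiM // addr0 mulr1.
pose chi y m := \prod_i y i ^ a m i.
have chiD y m m' : (forall i, y i != 0) -> chi y (m + m') = chi y m * chi y m'.
  by move=> hy; rewrite -big_split; apply: eq_bigr => i _; rewrite aD expfzDr.
suff H r : (r <= n)%N -> exists2 y, (forall i, y i != 0) &
    forall m, U m -> (forall j : 'I_n, (r <= j)%N -> a m j = 0) -> psi m = chi y m.
  have [y hy h] := H n (leqnn n); exists y => // m hm; apply: h => // j.
  by rewrite leqNgt ltn_ord.
elim: r => [_|r IH hr].
  exists (fun _ => 1) => [i|m hm h]; first exact: oner_neq0.
  have -> : m = 0 by apply: (coord_inj hc) => i; apply: h.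
  by rewrite psi1 /chi big1 // => i _; rewrite exp1rz.
have [y hy h] := IH (ltnW hr); pose ir := Ordinal hr.
pose vanish m := forall j : 'I_n, (r < j)%N -> a m j = 0.
have vanishr m : vanish m -> a m ir = 0 -> forall j : 'I_n, (r <= j)%N -> a m j = 0.
  move=> hv h0 j; rewrite leq_eqVlt => /orP [/eqP e|]; last exact: hv.
  by rewrite -h0; congr (a m _); apply: val_inj; rewrite /= -e.
have [hne|hn] := classic (exists e : nat, (0 < e)%N /\
    exists b, [/\ U b, vanish b & a b ir = e%:Z]); last first.
  exists y => // m hm hv; apply: h => //; apply: vanishr => //.
  have [//|/eqP h0] := classic (a m ir = 0); case: hn.
  exists `|a m ir|%N; split; first by rewrite absz_gt0.
  have [s|s] := ler0P (a m ir).
    exists (- m); split; [exact: UN| |by rewrite coordN ltz0_abs // lt_neqAle h0].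
    by move=> j hj; rewrite coordN hv // oppr0.
  by exists m; split=> //; rewrite gtz0_abs.
(* Among the elements of [U] supported on the first $r+1$ coordinates, [b] has the least positive
   last coordinate [e]. An [e]-th root fixes the value of the new coordinate by the formula at [b];
   subtracting [b] repeatedly reduces every other element to the previous rank. *)
have [e [e0 [b [Ub vb eb]]] emin] := ex_min_nat hne.
have [z ez] := nth_root (psi b / \prod_(i | i != ir) y i ^ a b i) e0.
have P0 : \prod_(i | i != ir) y i ^ a b i != 0.
  by apply/prodf_neq0 => i _; rewrite expfz_neq0.
have z0 : z != 0.
  apply: contraNneq (psi0 b Ub) => z0; move: ez; rewrite z0 expr0n gtn_eqF //= => /esym/eqP.
  by rewrite mulf_eq0 invr_eq0 (negPf P0) orbF.
pose y' i := if i == ir then z else y i.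
have hy' i : y' i != 0 by rewrite /y'; case: ifP.
have chib : psi b = chi y' b.
  rewrite /chi (bigD1 ir) //= eb /y' eqxx -exprnP ez.
  by under [X in _ * X]eq_bigr => i hi do rewrite (negPf hi); rewrite divfK.
have chi0 m : a m ir = 0 -> chi y' m = chi y m.
  move=> h0; apply: eq_bigr => i _; rewrite /y'; case: eqP => // ->.
  by rewrite h0 !expr0z.
exists y' => // m hm hv.
have pos N m' : U m' -> vanish m' -> a m' ir = N%:Z -> psi m' = chi y' m'.
  have [l] := ubnP N; elim: l N m' => // l IHl N m'; rewrite ltnS => hl Um' vm' em'.
  have [N0|N0] := posnP N; first by rewrite chi0 ?em' ?N0 // h //; apply: vanishr; rewrite ?em' ?N0.
  have eN : (e <= N)%N by apply: emin; split=> //; exists m'.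
  have -> : m' = (m' - b) + b by rewrite subrK.
  have Umb : U (m' - b) by apply: UD => //; apply: UN.
  rewrite psiM // chiD // -chib; congr (_ * _); apply: (IHl (N - e)%N) => //.
  - by apply: leq_trans hl; rewrite ltn_subrL e0 N0.
  - by move=> j hj; rewrite aD coordN vm' // vb // subr0.
  - by rewrite aD coordN em' eb subzn.
have [s|s] := ler0P (a m ir); last by apply: (pos `|a m ir|%N) => //; rewrite gtz0_abs.
have Nm : psi (- m) = chi y' (- m).
  apply: (pos `|a m ir|%N); [exact: UN| |by rewrite coordN lez0_abs].
  by move=> j hj; rewrite coordN hv // oppr0.
have h1 : psi m * psi (- m) = 1 by rewrite -psiM ?subrr //; apply: UN.
have h2 : chi y' m * chi y' (- m) = 1.
  by rewrite -chiD // subrr /chi big1 // => i _; rewrite coord0 expr0z.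
by apply: (mulIf (psi0 _ (UN _ hm))); rewrite h1 Nm h2.
Qed.

(** On the face of the semigroup where [x] is nonzero it comes from a character of the sublattice
    [U] spanned by that face, which extends to $\mathbb Z^n$; the coordinates with [x (dl i) = 0]
    are set to zero. *)
Lemma point_lift x : isPoint v x -> exists y, x = pt y.
Proof.
move=> hx; have [x1 xM xN] := hx; pose S i := x (dl i) != 0.
pose U m := forall i, ~~ S i -> a m i = 0.
pose w m i := if S i then degs m i else 0%N.
have xw m : x (dl_comb (w m)) != 0.
  rewrite point_comb //; apply/prodf_neq0 => i _; rewrite /w.
  by case: ifP => [hS|_]; [apply: expf_neq0|rewrite expr0 oner_neq0].
have dP m : U m -> inDual v (m + dl_comb (w m)).
  move=> hU; apply/(coord_dual hc) => i; rewrite aD coord_comb /w.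
  case: ifP => [_|/negbT/hU ->]; last by rewrite muln0.
  have := coord_gt0; case: (d) => // d' _; rewrite mulSn PoszD addrA addr_ge0 //.
  by rewrite abszE addrC -lerBlDr sub0r -normrN ler_norm.
have UD m m' : U m -> U m' -> U (m + m').
  by move=> h h' i hi; rewrite aD h // h' // addr0.
pose psi m := x (m + dl_comb (w m)) / x (dl_comb (w m)).
have [|||||y hy hpsi] := @character_extension U psi.
- by move=> i _; rewrite coord0.
- exact: UD.
- by move=> m h i hi; rewrite coordN h // oppr0.
- move=> m hm; rewrite mulf_neq0 ?invr_neq0 //.
  have : x (m + dl_comb (w m)) ^+ d != 0.
    rewrite point_exp //; last exact: dP.
    apply/prodf_neq0 => i _; have [hS|hS] := boolP (S i); first by rewrite expf_neq0.
    by rewrite /degs aD coord_comb /w (negPf hS) hm // muln0 addr0 expr0 oner_neq0.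
  by rewrite expf_eq0 coord_gt0.
- move=> m m' hm hm'; rewrite /psi mulf_div.
  apply/eqP; rewrite eqr_div ?mulf_neq0 //; apply/eqP.
  have dc := dual_comb.
  rewrite -!xM //; try by apply: dP => //; apply: UD.
  + by congr (x _); apply: coord_ext => i; rewrite !aD; ring.
  + by apply: dualD; apply: dP.
  + by apply: dualD.
exists (fun i => if S i then y i else 0); apply: functional_extensionality => m.
have [hm|hm] := boolP (dualb m); last first.
  by rewrite /pt (negPf hm) xN //; apply/dualP.
move/dualP: hm => hm; rewrite ptE //.
have [hU|hU] := classic (U m).
  have : x m = psi m by rewrite /psi xM ?mulfK //; exact: dual_comb.
  rewrite hpsi // => ->; apply: eq_bigr => i _.
  case: ifP => [_|/negbT hS]; first by rewrite -degsE.
  by rewrite /degs hU // expr0z expr0.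
have [i hi] : exists i, ~~ S i && (a m i != 0).
  apply: NNPP => hn; apply: hU => i hS; apply/eqP/negPn/negP => h0; apply: hn.
  by exists i; rewrite hS.
have [hS h0] := andP hi.
have -> : mon (degs m) (fun i => if S i then y i else 0) = 0.
  by apply/eqP; rewrite mon_eq0; apply/existsP; exists i; rewrite (negPf hS) eqxx absz_gt0.
apply/eqP; have : x m ^+ d == 0.
  rewrite point_exp // (bigD1 i) //= mulf_eq0 expf_eq0 absz_gt0 h0.
  by move: hS; rewrite /S negbK => ->.
by rewrite expf_eq0 coord_gt0.
Qed.

End Points.

(** * The regular locus *)

Section Regular.
Variables (k : closedFieldType) (hchar : [pchar k] =i pred0).
Variables (n : nat) (v : 'I_n -> 'rV[int]_n) (d : nat)
  (a : 'rV[int]_n -> 'I_n -> int) (dl : 'I_n -> 'rV[int]_n).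
Hypothesis hc : coordinates v d a dl.
Implicit Types (m : 'rV[int]_n) (y : 'I_n -> k) (x : Pt k n).

Let aD := coordD hc.

(** [option 'I_n] has $n+1$ elements: a square matrix of that size factoring through $k^n$ cannot be
    diagonal with nonzero diagonal entries. *)
Lemma no_independent_family (T : Type) (B : 'I_n -> T -> k)
    (E : option 'I_n -> T -> k) (tau : option 'I_n -> T) :
  (forall o, exists c : 'I_n -> k, forall u, E o u = \sum_i c i * B i u) ->
  (forall o, E o (tau o) != 0) -> (forall o o', o != o' -> E o (tau o') = 0) -> False.
Proof.
move=> hspan hdiag hoff.
have [C hC] := choice _ hspan.
pose u (r : 'I_n.+1) := unlift ord0 r.
have uinj : injective u.
  by move=> r s; rewrite /u; case: unliftP => [i ->|->]; case: unliftP => [j ->|->] // [->].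
pose P : 'M_n.+1 := \matrix_(r, s) E (u r) (tau (u s)).
have PE : P = (\matrix_(r < n.+1, i < n) C (u r) i) *m (\matrix_(i < n, s < n.+1) B i (tau (u s))).
  by apply/matrixP => r s; rewrite !mxE hC; apply: eq_bigr => i _; rewrite !mxE.
have Pd : P = diag_mx (\row_r E (u r) (tau (u r))).
  apply/matrixP => r s; rewrite !mxE; case: eqP => [->|/eqP rs]; first by rewrite mulr1n.
  by rewrite mulr0n hoff //; apply: contraNneq rs => /uinj ->.
have : P \in unitmx.
  rewrite unitmxE Pd det_diag unitfE; apply/prodf_neq0 => r _; rewrite mxE; exact: hdiag.
rewrite -row_free_unit -row_leq_rank leqNgt ltnS; move/negP; apply.
by rewrite PE mulmx_max_rank.
Qed.

(** * Tangent vectors at a point of the toric variety *)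

Section Derivations.
Variable y : 'I_n -> k.

(** The logarithmic derivation $y_j\,\partial/\partial y_j$ at [y]. *)
Definition coord_deriv j m : k := (degs a m j)%:R * pt a y m.

Lemma coord_deriv_ok j : point_derivation v (pt a y) (coord_deriv j).
Proof.
split=> [m m' h h'|m /(dualP hc) /negPf h]; last by rewrite /coord_deriv /pt h mulr0.
have [_ xM _] := pt_isPoint hc y.
by rewrite /coord_deriv (degsD hc) // natrD xM //; ring.
Qed.

Definition matches (al : 'I_n -> nat) m :=
  [forall l, (y l == 0) ==> (a m l == (al l)%:Z)].

Definition unit_part m : k := \prod_(l | y l != 0) y l ^+ degs a m l.

Lemma unit_part_neq0 m : unit_part m != 0.
Proof. by apply/prodf_neq0 => l hl; rewrite expf_neq0. Qed.

Lemma pt_unit_part m : inDual v m -> pt a y m = (matches (fun=> 0%N) m)%:R * unit_part m.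
Proof.
move=> h; rewrite (ptE hc) // /mon (bigID (fun l => y l == 0)) /=; congr (_ * _).
have [/forallP hm|/forallPn [l]] := boolP (matches _ m).
  rewrite big1 // => l hl; have := hm l; rewrite hl /= => /eqP e.
  by rewrite /degs e expr0.
rewrite negb_imply => /andP [hl al0]; rewrite (bigD1 l) //= (eqP hl) expr0n.
by rewrite absz_eq0 (negPf al0) mul0r.
Qed.

(** A character is nonzero at [y] exactly when its exponents vanish wherever [y] does. Grading the
    semigroup by the exponents at the zeros of [y], each nonzero indecomposable degree [al]
    contributes this tangent vector. *)
Definition face_deriv al m : k := if dualb a m && matches al m then unit_part m else 0.

Lemma face_deriv_ok al : (exists2 l, y l == 0 & al l != 0%N) ->
  (forall m m', inDual v m -> inDual v m' -> matches al (m + m') ->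
     matches (fun=> 0%N) m \/ matches (fun=> 0%N) m') ->
  point_derivation v (pt a y) (face_deriv al).
Proof.
move=> [l0 yl0 al0] hind; split=> [m m' h h'|m /(dualP hc) /negPf h]; last by rewrite /face_deriv h.
have h2 := dualD hc h h'.
have zM m1 m2 : matches (fun=> 0%N) m1 -> matches al (m1 + m2) = matches al m2.
  move=> /forallP hz; apply: eq_forallb => l; case: (boolP (y l == 0)) => // hl.
  by have := hz l; rewrite hl aD /= => /eqP ->; rewrite add0r.
have zN m1 : matches (fun=> 0%N) m1 -> matches al m1 = false.
  move=> /forallP hz; apply/negP => /forallP /(_ l0); have := hz l0; rewrite yl0 /=.
  by move=> /eqP ->; rewrite eq_sym eqz_nat (negPf al0).
have uM : unit_part (m + m') = unit_part m * unit_part m'.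
  by rewrite -big_split; apply: eq_bigr => l _; rewrite (degsD hc) // exprD.
rewrite /face_deriv (introT (dualP hc _) h) (introT (dualP hc _) h') (introT (dualP hc _) h2) /=.
rewrite !pt_unit_part // uM.
have [z|z] := boolP (matches (fun=> 0%N) m); first by rewrite (zM m m') // (zN m) // mulr0 addr0 mul1r; case: ifP; rewrite ?mulr0.
have [z'|z'] := boolP (matches (fun=> 0%N) m').
  rewrite [m + m']addrC (zM m' m) // (zN m') // mulr0 add0r mul1r; case: ifP => _; rewrite ?mulr0 //; exact: mulrC.
rewrite !mul0r addr0; case: ifP => // hm.
by case: (hind _ _ h h' hm) => e; [rewrite e in z|rewrite e in z'].
Qed.

(* Otherwise the tangent space has dimension at least [n + 1]: besides the
   derivations of the coordinates with [y j <> 0], each indecomposable element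
   of the projection of the semigroup to the vanishing coordinates contributes
   one.  These elements are the generators [c j e_j] of the rays and, when
   [c i > 1], a minimal element whose [i]-th coordinate is not divisible by
   [c i]. *)
Lemma regular_primitive : regular_point v (pt a y) ->
  forall i, y i = 0 -> exists m, forall j, y j = 0 -> a m j = (j == i)%:R.
Proof.
move=> [_ [B [_ [Bspan _]]]] i yi; apply: NNPP => hno.
pose onZ (c : nat) j m := forall l, y l = 0 -> a m l = (c * (l == j))%N.
have htest j : exists p : nat * 'rV[int]_n, [/\ (0 < p.1)%N, inDual v p.2, onZ p.1 j p.2 &
    if y j == 0 then (forall c m, (0 < c)%N -> onZ c j m -> (p.1 <= c)%N)
    else p.2 = dl j].
  have onZdl : onZ d j (dl j).
    by move=> l _; rewrite (coord_dl hc) eq_sym; case: eqP; rewrite ?muln1 ?muln0.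
  have d0 := coord_gt0 hc.
  have [yj|yj] := boolP (y j == 0); last by exists (d, dl j); split=> //; apply: (dual_dl hc).
  have [|c [c0 [m hm]] cmin] := @ex_min_nat (fun c => (0 < c)%N /\ exists m, onZ c j m).
    by exists d; split=> //; exists (dl j).
  have [|m' dm' em'] := @dual_shift _ _ _ _ _ hc (fun l => y l == 0) m.
    by move=> l /eqP /hm ->.
  exists (c, m'); split=> //= [l hl|c' m1 hc' hm1]; first by rewrite em' ?hm //; apply/eqP.
  by apply: cmin; split=> //; exists m1.
have [te te_] := choice _ htest; pose c j := (te j).1; pose tm j := (te j).2.
have c0 j : (0 < c j)%N by case: (te_ j).
have tmd j : inDual v (tm j) by case: (te_ j).
have tmZ j : onZ (c j) j (tm j) by case: (te_ j).
have cmin j c' m : y j == 0 -> (0 < c')%N -> onZ c' j m -> (c j <= c')%N.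
  by move=> yj; case: (te_ j) => _ _ _; rewrite yj; apply.
have tmdl j : y j != 0 -> tm j = dl j by move=> /negPf yj; case: (te_ j) => _ _ _; rewrite yj.
have ci : ~~ (c i %| 1)%N.
  rewrite dvdn1; apply/negP => /eqP e; apply: hno; exists (tm i) => j yj.
  by rewrite tmZ // e mul1n; case: eqP.
pose deg m := (\sum_(l | y l == 0%R) degs a m l)%N.
(* Such elements exist because [i]-th coordinate $1$ is attained and [c i] does not divide it.
   Minimality of [deg] gives indecomposability: two summands of smaller degree would both have
   [i]-th exponent divisible by [c i]. *)
have [|_ [mb [db [nb ->]]] bmin] := @ex_min_nat
    (fun e => exists m, inDual v m /\ ~~ (c i %| degs a m i)%N /\ e = deg m).
  have [m hm] := coord_prim hc i.
  have [|m' dm' em'] := @dual_shift _ _ _ _ _ hc (pred1 i) m.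
    by move=> l /eqP ->; rewrite hm.
  by exists (deg m'), m'; rewrite /degs em' ?hm /=.
pose E o := match o with
  | Some j => if y j == 0 then face_deriv (fun l => c j * (l == j))%N else coord_deriv j
  | None => face_deriv (degs a mb) end.
pose tau o := match o with Some j => tm j | None => mb end.
have matchP al m l : matches al m -> y l = 0 -> a m l = al l.
  by move=> /forallP /(_ l) + yl; rewrite yl eqxx => /eqP.
have mbd := fun l => degsE hc l db.
have E_ok o : point_derivation v (pt a y) (E o).
  case: o => [j|] /=; last first.
    apply: face_deriv_ok; first by exists i; [apply/eqP|apply: contraNneq nb => ->; rewrite dvdn0].
    move=> m m' h h' hm; apply/orP; apply: contraNT nb; rewrite negb_or => /andP [z z'].
    have pos m1 : inDual v m1 -> ~~ matches (fun=> 0%N) m1 -> (0 < deg m1)%N.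
      move=> h1 /forallPn [l]; rewrite negb_imply => /andP [yl hl].
      by rewrite /deg (bigD1 l) //= addn_gt0 absz_gt0 hl.
    have eb l : y l = 0 -> degs a mb l = (degs a m l + degs a m' l)%N.
      move=> yl; rewrite -(degsD hc) //; apply/eqP; rewrite -eqz_nat mbd (degsE hc); last exact: (dualD hc).
      by rewrite (matchP _ _ _ hm yl) mbd.
    have ed : deg mb = (deg m + deg m')%N.
      by rewrite -big_split; apply: eq_bigr => l /eqP; apply: eb.
    have dv m1 : inDual v m1 -> (deg m1 < deg mb)%N -> (c i %| degs a m1 i)%N.
      move=> h1; apply: contraTT => hn; rewrite -leqNgt; apply: bmin.
      by exists m1.
    rewrite eb // dvdn_add // dv // ed.
      by rewrite -[X in (X < _)%N]addn0 ltn_add2l pos.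
    by rewrite -[X in (X < _)%N]add0n ltn_add2r pos.
  have [yj|yj] := boolP (y j == 0); last exact: coord_deriv_ok.
  apply: face_deriv_ok; first by exists j; rewrite // eqxx muln1 -lt0n.
  move=> m m' h h' hm.
  have e l : y l = 0 -> (degs a m l + degs a m' l = c j * (l == j))%N.
    move=> yl; rewrite -(degsD hc) //; apply/eqP; rewrite -eqz_nat (degsE hc) //; last exact: (dualD hc).
    by rewrite (matchP _ _ _ hm yl).
  have zero l : y l = 0 -> l != j -> degs a m l = 0%N /\ degs a m' l = 0%N.
    move=> yl /negPf lj; have := e l yl; rewrite lj muln0 => /eqP.
    by rewrite addn_eq0 => /andP [/eqP -> /eqP ->].
  have ej := e j (eqP yj); rewrite eqxx muln1 in ej.
  have [mj|mj] := posnP (degs a m j).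
    left; apply/forallP => l; apply/implyP => /eqP yl; rewrite -(degsE hc) // eqz_nat.
    by have [->|lj] := eqVneq l j; [rewrite mj|rewrite (zero l yl lj).1].
  right; apply/forallP => l; apply/implyP => /eqP yl; rewrite -(degsE hc) // eqz_nat.
  have [->|lj] := eqVneq l j; last by rewrite (zero l yl lj).2.
  have : (c j <= degs a m j)%N.
    apply: (cmin j _ m) => // l1 yl1; rewrite -(degsE hc) //; congr Posz.
    by have [->|l1j] := eqVneq l1 j; rewrite ?muln1 // muln0 (zero l1 yl1 l1j).1.
  by rewrite -ej -[X in (_ <= X)%N]addn0 leq_add2l leqn0.
apply: (@no_independent_family _ B E tau) => [o|o|o o' oo'].
- exact: Bspan (E_ok o).
- case: o => [j|] /=; last first.
    rewrite /face_deriv (introT (dualP hc _) db) /=.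
    have -> : matches (degs a mb) mb by apply/forallP => l; rewrite mbd eqxx implybT.
    exact: unit_part_neq0.
  have [yj|yj] := boolP (y j == 0).
    rewrite /face_deriv (introT (dualP hc _) (tmd j)) /=.
    have -> : matches (fun l => c j * (l == j))%N (tm j).
      by apply/forallP => l; apply/implyP => /eqP yl; rewrite tmZ.
    exact: unit_part_neq0.
  rewrite /coord_deriv tmdl // (pt_dl hc) /degs (coord_dl hc) eqxx mulr1n absz_nat.
  by rewrite mulf_neq0 ?expf_neq0 // (natr_neq0 hchar) // (coord_gt0 hc).
have pt_vanish m : inDual v m -> (exists2 l, y l = 0 & degs a m l != 0%N) -> pt a y m = 0.
  move=> h [l yl hl]; rewrite (ptE hc) //; apply/eqP; rewrite mon_eq0; apply/existsP; exists l.
  by rewrite yl eqxx lt0n.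
have nbi : degs a mb i != 0%N by apply: contraNneq nb => ->; rewrite dvdn0.
have cdiv j : (c i %| c j * (i == j))%N.
  by case: eqP => [<-|_]; rewrite ?muln1 ?muln0.
case: o oo' => [j|] oo' /=.
  have [yj|yj] := boolP (y j == 0).
    rewrite /face_deriv; case: ifP => // /andP [_ hm]; case: o' oo' hm => [j'|] oo' /= hm.
      have := matchP _ _ _ hm (eqP yj); rewrite tmZ; last exact/eqP.
      rewrite eqxx muln1; have -> : (j == j') = false by apply: contraNF oo' => /eqP ->.
      by rewrite muln0 => /eqP; rewrite eqz_nat eq_sym -leqn0 leqNgt c0.
    have := matchP _ _ _ hm yi; rewrite -mbd => /eqP; rewrite eqz_nat => /eqP e.
    by move: nb; rewrite e cdiv.
  rewrite /coord_deriv; case: o' oo' => [j'|] oo' /=; last first.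
    by rewrite (pt_vanish mb) ?mulr0 //; exists i.
  have [yj'|yj'] := boolP (y j' == 0).
    rewrite (pt_vanish (tm j')) ?mulr0 //; exists j'; first exact/eqP.
    by rewrite /degs tmZ ?eqxx ?muln1 /= -?lt0n //; apply/eqP.
  rewrite tmdl // /degs (coord_dl hc) (negPf (_ : j' != j)) ?mul0r //.
  by apply: contraNneq oo' => ->.
case: o' oo' => [j|] // _ /=; rewrite /face_deriv; case: ifP => // /andP [_ hm].
have := matchP _ _ _ hm yi; rewrite tmZ // => /eqP; rewrite eqz_nat => /eqP e.
by move: nb; rewrite -e cdiv.
Qed.

End Derivations.
End Regular.

(** * Consequences of smoothness in codimension two *)

Section CodimTwo.
Variables (k : closedFieldType) (hchar : [pchar k] =i pred0).
Variables (n : nat) (v : 'I_n -> 'rV[int]_n) (d : nat)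
  (a : 'rV[int]_n -> 'I_n -> int) (dl : 'I_n -> 'rV[int]_n).
Hypothesis hc : coordinates v d a dl.
Implicit Types (m : 'rV[int]_n) (y : 'I_n -> k) (x : Pt k n).

Lemma mon_line al y y' : exists P : {poly k}, forall c,
  mon al (fun i => y i + c * (y' i - y i)) = P.[c].
Proof.
exists (\prod_i ((y i)%:P + (y' i - y i) *: 'X) ^+ al i) => c.
by rewrite horner_prod; apply: eq_bigr => i _; rewrite !hornerE mulrC.
Qed.

Lemma regular_fun_line g y y' : regular_fun v g -> exists P : {poly k}, forall c,
  g (pt a (fun i => y i + c * (y' i - y i))) = P.[c].
Proof.
move=> [s [hs hg]]; have H c := hg _ (pt_isPoint hc (fun i => y i + c * (y' i - y i))).
suff [P hP] : exists P : {poly k}, forall c,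
    \sum_(p <- s) p.1 * pt a (fun i => y i + c * (y' i - y i)) p.2 = P.[c].
  by exists P => c; rewrite H.
elim: s hs {hg H} => [|p s IH] hs; first by exists 0 => c; rewrite big_nil horner0.
have [P hP] := IH (fun q hq => hs q (mem_behead (s := p :: s) hq)).
have [Q hQ] := mon_line (degs a p.2) y y'.
exists (p.1 *: Q + P) => c; rewrite big_cons hP (ptE hc) ?hQ ?hornerE //.
by apply: hs; rewrite mem_head.
Qed.

Definition coord_subspace (T : pred 'I_n) x :=
  isPoint v x /\ forall l, ~~ T l -> x (dl l) = 0.

Lemma coord_subspaceP T x :
  coord_subspace T x <-> exists2 y, x = pt a y & forall l, ~~ T l -> y l = 0.
Proof.
split=> [[hx h]|[y -> h]]; last first.
  by split=> [|l /h e]; [exact: (pt_isPoint hc y)|rewrite (pt_dl hc) e expr0n gtn_eqF // (coord_gt0 hc)].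
have [y ey] := point_lift hc hx; exists y => // l /h.
by rewrite ey (pt_dl hc) => /eqP; rewrite expf_eq0 => /andP [_ /eqP].
Qed.

(** Two points lift to a coordinate subspace of $\mathbb A^n$ and are joined there by a line, along
    which regular functions are polynomials; two functions nonzero at the respective ends are
    nonzero at a common point. *)
Lemma coord_subspace_irreducible T : irreducible_closed v (coord_subspace T).
Proof.
split.
- exists (fun g => exists2 l, ~~ T l & g = fun x => x (dl l)); split.
    move=> _ [l _ ->]; exists [:: (1, dl l)]; split=> [p|x _].
      by rewrite inE => /eqP ->; exact: (dual_dl hc).
    by rewrite big_seq1 mul1r.
  move=> x; split=> -[hx h]; split=> //.
    by move=> _ [l hl ->]; apply: h.
  by move=> l hl; apply: (h (fun x => x (dl l))); exists l.
- by exists (pt a (fun _ => 0)); apply/coord_subspaceP; exists (fun _ => 0).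
move=> Z1 Z2 [F1 [hF1 hZ1]] [F2 [hF2 hZ2]] hZ; apply: NNPP => /not_or_and [n1 n2].
have sep (Z : Pt k n -> Prop) (F : (Pt k n -> k) -> Prop) : (forall x, Z x <-> isPoint v x /\ forall g, F g -> g x = 0) ->
    ~ (forall x, coord_subspace T x -> Z x) ->
    exists y g, [/\ forall l, ~~ T l -> y l = 0, F g & g (pt a y) != 0].
  move=> hZF hn; apply: NNPP => hn'; apply: hn => x hx.
  have /coord_subspaceP [y ey hy] := hx.
  apply/hZF; split=> [|g Fg]; first by case: hx.
  apply: NNPP => hg; apply: hn'; exists y, g; split=> //.
  by apply/eqP; rewrite -ey.
have [y1 [g1 [hy1 Fg1 hg1]]] := sep _ _ hZ1 n1.
have [y2 [g2 [hy2 Fg2 hg2]]] := sep _ _ hZ2 n2.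
have [P1 hP1] := regular_fun_line y1 y2 (hF1 _ Fg1).
have [P2 hP2] := regular_fun_line y1 y2 (hF2 _ Fg2).
have e0 : (fun i => y1 i + 0 * (y2 i - y1 i)) = y1.
  by apply: functional_extensionality => i; rewrite mul0r addr0.
have e1 : (fun i => y1 i + 1 * (y2 i - y1 i)) = y2.
  by apply: functional_extensionality => i; rewrite mul1r addrC subrK.
have P10 : P1 != 0 by apply: contraNneq hg1 => e; rewrite -e0 hP1 e horner0.
have P20 : P2 != 0 by apply: contraNneq hg2 => e; rewrite -e1 hP2 e horner0.
have [c] := exists_nonroot (mulf_neq0 P10 P20).
rewrite rootM negb_or !rootE -hP1 -hP2 => /andP [c1 c2].
set y := fun i => _ in c1 c2.
have : coord_subspace T (pt a y).
  apply/coord_subspaceP; exists y => // l hl.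
  by rewrite /y hy1 // hy2 // subrr mulr0 addr0.
case/hZ => [/hZ1|/hZ2] [_].
  by move/(_ _ Fg1) => /eqP; apply/negP.
by move/(_ _ Fg2) => /eqP; apply/negP.
Qed.

(* Otherwise the coordinate subspaces contained in [y i = y j = 0] form a chain
   of length [n - 2] in the singular locus. *)
Lemma codim2_primitive_pair : @smooth_in_codim2 k n v ->
  forall i j, i != j -> exists m, a m i = 1 /\ a m j = 0.
Proof.
move=> hcod i j ij; apply: NNPP => hno; apply: hcod.
pose e := [seq l <- enum 'I_n | (l != i) && (l != j)].
have se : size e = (n - 2)%N.
  have -> : size e = #|[predC pred2 i j]|.
    rewrite cardE /e enumT /enum_mem; congr size; apply: eq_filter => l.
    by rewrite !inE negb_or.
  by have := cardC (pred2 i j); rewrite card2 ij card_ord => h; rewrite -[X in _ = (X - 2)%N]h addKn.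
have ue : uniq e by rewrite filter_uniq // enum_uniq.
pose Z r := coord_subspace (fun l => l \in take r e).
exists Z; split=> [r hr|r hr].
  split; first exact: coord_subspace_irreducible.
  move=> x hx; split; first by case: hx.
  have /coord_subspaceP [y -> hy] := hx.
  move=> /(regular_primitive hchar hc) H.
  have out l : (l == i) || (l == j) -> y l = 0.
    move=> hl; apply: hy; apply/negP => /mem_take; rewrite mem_filter.
    by rewrite -negb_or hl.
  have [|m hm] := H i _; first by apply: out; rewrite eqxx.
  apply: hno; exists m; rewrite !hm ?out ?eqxx ?orbT //.
  by rewrite eq_sym (negPf ij).
split.
  move=> x [hx h]; split=> // l hl; apply: h; apply: contra hl.
  by rewrite -addn1 takeD mem_cat => ->.
pose z := nth i e r.
have zin : z \in take r.+1 e.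
  have hr' : (r < size e)%N by rewrite se.
  by rewrite (take_nth i) // mem_rcons mem_head.
exists (pt a (fun l => (l == z)%:R)); split.
  apply/coord_subspaceP; exists (fun l => (l == z)%:R) => // l hl.
  by case: eqP hl => // ->; rewrite zin.
move=> [_ /(_ z)]; rewrite (pt_dl hc) eqxx expr1n => h.
have : z \notin take r e.
  by rewrite in_take ?index_uniq ?ltnn ?mem_nth ?se.
by move=> /h /eqP; rewrite oner_eq0.
Qed.

End CodimTwo.

(** * Semi-invariant polynomial functions *)

Section SemiInvariants.
Variables (k : closedFieldType) (n : nat) (v : 'I_n -> 'rV[int]_n) (d : nat)
  (a : 'rV[int]_n -> 'I_n -> int) (dl : 'I_n -> 'rV[int]_n).
Hypothesis hc : coordinates v d a dl.
Implicit Types (m : 'rV[int]_n) (y : 'I_n -> k) (x : Pt k n).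

Let aD := coordD hc.

Lemma coordMz m (z : int) i : a (m *~ z) i = a m i * z.
Proof.
case: z => e; rewrite ?NegzE ?mulrNz ?(coordN hc) -?pmulrn ?(coordMn hc).
  by rewrite -mulr_natr natz.
by rewrite mulrN -mulr_natr natz.
Qed.

(** Equality in $\mathbb Z^n/a(M)$, the character group of $G$. *)
Definition cong (b b' : 'I_n -> int) := exists m, forall i, b i = b' i + a m i.

Lemma congxx b : cong b b.
Proof. by exists 0 => i; rewrite (coord0 hc) addr0. Qed.

Lemma cong_eq b b' : (forall i, b i = b' i) -> cong b b'.
Proof. by move=> h; exists 0 => i; rewrite (coord0 hc) addr0. Qed.

Lemma cong_trans b b' b'' : cong b b' -> cong b' b'' -> cong b b''.
Proof. by move=> [m h] [m' h']; exists (m' + m) => i; rewrite aD h h' addrA. Qed.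

Lemma congD b b' e e' : cong b b' -> cong e e' ->
  cong (fun i => b i + e i) (fun i => b' i + e' i).
Proof. by move=> [m h] [m' h']; exists (m + m') => i; rewrite aD h h' addrACA. Qed.

Definition zdeg (al : 'I_n -> nat) i := (al i)%:Z.
Definition unitw (i : 'I_n) := fun j => (j == i)%:R : int.

(** The given characters clear the coordinates of [b] in [Z], and multiples of [d] make the others
    nonnegative. When [Z] contains all coordinates vanishing at a point, this is a monomial of
    weight [b] that is nonzero there. *)
Lemma weight_off_face (Z : pred 'I_n) :
  (forall i, Z i -> exists m, forall j, Z j -> a m j = (j == i)%:R) ->
  forall b, exists2 al, (forall i, Z i -> al i = 0%N) & cong (zdeg al) b.
Proof.
move=> h b; have h' i : exists m, Z i -> forall j, Z j -> a m j = (j == i)%:R.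
  by have [/h [m hm]|hn] := boolP (Z i); [exists m|exists 0].
have [M hM] := choice _ h'.
pose m0 := - \sum_(i | Z i) M i *~ b i.
have m0Z j : Z j -> b j + a m0 j = 0.
  move=> hj; rewrite (coordN hc) -big_filter (coord_sum hc) big_filter (bigD1 j) //=.
  rewrite big1 => [|i /andP [hi ij]]; rewrite coordMz hM //.
    by rewrite eqxx mul1r addr0 subrr.
  by rewrite eq_sym (negPf ij) mul0r.
pose m := m0 + dl_comb dl (fun i => if Z i then 0%N else absz (b i + a m0 i)).
exists (fun i => absz (b i + a m i)) => [i hi|].
  by rewrite /m aD (coord_comb hc) hi muln0 addr0 m0Z.
exists m => i; rewrite /zdeg gez0_abs // /m aD (coord_comb hc).
case: ifP => [hi|_]; first by rewrite muln0 addr0 m0Z.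
rewrite addrA; have := coord_gt0 hc; case: (d) => // d' _; rewrite mulSn PoszD addrA addr_ge0 //.
by rewrite abszE addrC -lerBlDr sub0r -normrN ler_norm.
Qed.

(* [semi J b Q]: [Q] is a combination of monomials in the variables of [J]
   whose degree is [b] modulo the lattice [a(M)]. *)
Inductive semi (J : pred 'I_n) (b : 'I_n -> int) : (('I_n -> k) -> k) -> Prop :=
| semi0 Q : (forall y, Q y = 0) -> semi J b Q
| semiS Q Q' c al : semi J b Q' -> (forall i, ~~ J i -> al i = 0%N) ->
    cong (zdeg al) b -> (forall y, Q y = Q' y + c * mon al y) -> semi J b Q.

Lemma semi_ext J b Q Q' : semi J b Q -> (forall y, Q' y = Q y) -> semi J b Q'.
Proof.
case=> [Q0 h e|Q0 Q1 c al h hJ hb hQ e]; first by apply: semi0 => y; rewrite e.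
by apply: (semiS (c := c) h hJ hb) => y; rewrite e.
Qed.

Lemma semi_cong J b b' Q : cong b b' -> semi J b Q -> semi J b' Q.
Proof.
move=> hb; elim=> [Q0 h|Q0 Q1 c al _ IH hJ hal e]; first exact: semi0.
by apply: (semiS (c := c) IH hJ) => //; apply: cong_trans hb.
Qed.

Lemma semi_sub (J J' : pred 'I_n) b Q : (forall i, J i -> J' i) -> semi J b Q -> semi J' b Q.
Proof.
move=> sJ; elim=> [Q0 h|Q0 Q1 c al _ IH hJ hal e]; first exact: semi0.
apply: (semiS (c := c) (al := al) IH) => // i hi; apply: hJ; apply: contra hi; exact: sJ.
Qed.

Lemma semi_mon (J : pred 'I_n) b al : (forall i, ~~ J i -> al i = 0%N) -> cong (zdeg al) b ->
  semi J b (mon al).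
Proof.
move=> hJ hb; apply: (@semiS _ _ _ (fun _ => 0) 1 al) => //; first exact: semi0.
by move=> y; rewrite add0r mul1r.
Qed.

Lemma semiD J b Q Q' : semi J b Q -> semi J b Q' -> semi J b (fun y => Q y + Q' y).
Proof.
move=> hQ; elim=> [Q0 h|Q0 Q1 c al _ IH hJ hal e].
  by apply: (semi_ext hQ) => y; rewrite h addr0.
by apply: (semiS (c := c) IH hJ hal) => y; rewrite e addrA.
Qed.

Lemma semi_mulmon J b b' c al Q : (forall i, ~~ J i -> al i = 0%N) -> cong (zdeg al) b' ->
  semi J b Q -> semi J (fun i => b i + b' i) (fun y => Q y * (c * mon al y)).
Proof.
move=> hJ hal; elim=> [Q0 h|Q0 Q1 c' al' _ IH hJ' hal' e].
  by apply: semi0 => y; rewrite h mul0r.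
apply: (semiS (c := c' * c) (al := fun i => (al' i + al i)%N) IH).
- by move=> i hi; rewrite hJ // hJ'.
- apply: (@cong_trans _ (fun i => zdeg al' i + zdeg al i)); last exact: congD.
  by apply: cong_eq => i; rewrite /zdeg PoszD.
- by move=> y; rewrite e monD; ring.
Qed.

Lemma semiM J b b' Q Q' : semi J b Q -> semi J b' Q' ->
  semi J (fun i => b i + b' i) (fun y => Q y * Q' y).
Proof.
move=> hQ; elim=> [Q0 h|Q0 Q1 c al _ IH hJ hal e].
  by apply: semi0 => y; rewrite h mulr0.
apply: (semi_ext (semiD IH (semi_mulmon c hJ hal hQ))) => y.
by rewrite e mulrDr.
Qed.

Lemma semiC J c : semi J (fun=> 0) (fun _ => c).
Proof.
apply: (@semiS _ _ _ (fun _ => 0) c (fun=> 0%N)) => //; [exact: semi0|exact: congxx|].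
by move=> y; rewrite add0r /mon big1 ?mulr1 // => i _; rewrite expr0.
Qed.

Lemma semiZ J b c Q : semi J b Q -> semi J b (fun y => c * Q y).
Proof.
move=> hQ; apply: semi_cong (semiM (semiC J c) hQ).
by apply: cong_eq => i; rewrite add0r.
Qed.

Lemma semi_var (J : pred 'I_n) i : J i -> semi J (unitw i) (fun y => y i).
Proof.
move=> hi; apply: (semi_ext (Q := mon (fun j => nat_of_bool (j == i)))).
  apply: semi_mon => [j hj|]; first by case: eqP hj => // ->; rewrite hi.
  by apply: cong_eq => j; rewrite /zdeg /unitw natz.
move=> y; rewrite /mon (bigD1 i) //= eqxx expr1 big1 ?mulr1 // => j /negPf ->.
by rewrite expr0.
Qed.

Lemma semiX J b Q e : semi J b Q -> semi J (fun i => b i *+ e) (fun y => Q y ^+ e).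
Proof.
move=> hQ; elim: e => [|e IH]; first exact: semiC.
apply: (semi_ext (Q := fun y => Q y * Q y ^+ e)) => [|y]; last by rewrite exprS.
by apply: semi_cong (semiM hQ IH); apply: cong_eq => i; rewrite mulrS.
Qed.

Lemma semi_local (J : pred 'I_n) b Q y y' :
  semi J b Q -> (forall i, J i -> y i = y' i) -> Q y = Q y'.
Proof.
move=> hQ h; elim: hQ => [Q0 h0|Q0 Q1 c al _ IH hJ hal e]; first by rewrite !h0.
rewrite !e IH; congr (_ + _ * _); apply: eq_bigr => i _.
by have [/h ->|/hJ ->] := boolP (J i); rewrite ?expr0.
Qed.

Definition upd (T : Type) (f : 'I_n -> T) i h j := if j == i then h else f j.

Lemma semi_delete b Q i : semi predT b Q -> semi (predC1 i) b (fun y => Q (upd y i 0)).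
Proof.
elim=> [Q0 h|Q0 Q1 c al _ IH hJ hal e]; first exact: semi0.
have [ai|ai] := posnP (al i).
  apply: (semiS (c := c) (al := al) IH) => // [j|y].
    by rewrite negbK => /eqP ->.
  rewrite e; congr (_ + _ * _); apply: eq_bigr => j _; rewrite /upd.
  by case: eqP => // ->; rewrite ai !expr0.
apply: (semi_ext IH) => y; rewrite e.
have -> : mon al (upd y i 0) = 0.
  by apply/eqP; rewrite mon_eq0; apply/existsP; exists i; rewrite /upd !eqxx.
by rewrite mulr0 addr0.
Qed.

Definition equivariant (T : ('I_n -> k) -> 'I_n -> k) :=
  forall i, semi predT (unitw i) (fun y => T y i).

Lemma semi_comp_mon T al : equivariant T -> semi predT (zdeg al) (fun y => mon al (T y)).
Proof.
move=> hT.
suff H (r : seq 'I_n) : semi predT (fun j => \sum_(i <- r) unitw i j *+ al i)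
    (fun y => \prod_(i <- r) T y i ^+ al i).
  apply: semi_cong (H (index_enum _)); apply: cong_eq => j.
  rewrite (bigD1 j) //= big1 ?addr0 => [|i ij]; rewrite /unitw.
    by rewrite eqxx /zdeg -natz.
  by rewrite eq_sym (negPf ij) mul0rn.
elim: r => [|i r IH].
  apply: (semi_ext (Q := fun _ => 1)) => [|y]; last by rewrite big_nil.
  by apply: semi_cong (semiC predT 1); apply: cong_eq => j; rewrite big_nil.
apply: (semi_ext (Q := fun y => T y i ^+ al i * \prod_(j <- r) T y j ^+ al j)) => [|y].
  by apply: semi_cong (semiM (semiX (al i) (hT i)) IH); apply: cong_eq => j; rewrite big_cons.
by rewrite big_cons.
Qed.

Lemma semi_comp T b Q : equivariant T -> semi predT b Q -> semi predT b (fun y => Q (T y)).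
Proof.
move=> hT; elim=> [Q0 h|Q0 Q1 c al _ IH hJ hal e]; first by apply: semi0.
apply: (semi_ext (semiD IH (semiZ c (semi_cong hal (semi_comp_mon al hT))))) => y.
exact: e.
Qed.

Lemma equivariant_comp T T' : equivariant T -> equivariant T' ->
  equivariant (fun y => T (T' y)).
Proof. by move=> hT hT' i; apply: (semi_comp hT' (hT i)). Qed.

Lemma equivariant_id : equivariant id.
Proof. by move=> i; apply: semi_var. Qed.

Lemma semi_invariant_regular Q : semi predT (fun=> 0) Q ->
  exists s : seq (k * 'rV[int]_n), (forall p, p \in s -> inDual v p.2) /\
    forall y, Q y = \sum_(p <- s) p.1 * pt a y p.2.
Proof.
elim=> [Q0 h|Q0 Q1 c al _ [s [hs e]] _ [m hm] hQ]; first by exists [::]; split=> // y; rewrite big_nil.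
have em i : a m i = al i by have := hm i; rewrite add0r => <-.
have dm : inDual v m by apply/(coord_dual hc) => i; rewrite em.
exists ((c, m) :: s); split=> [p|y].
  by rewrite inE => /orP [/eqP ->|/hs].
rewrite big_cons hQ e addrC (ptE hc) //; congr (_ * _ + _).
by apply: eq_bigr => i _; rewrite /degs em absz_nat.
Qed.

Lemma semi_degs J m : (forall i, ~~ J i -> degs a m i = 0%N) -> inDual v m ->
  semi J (fun=> 0) (mon (degs a m)).
Proof.
move=> hJ h; apply: semi_mon => //; exists m => i.
by rewrite add0r /zdeg (degsE hc).
Qed.

Lemma equivariant_automorphism T T' : equivariant T -> equivariant T' ->
  (forall y, T' (T y) = y) -> (forall y, T (T' y) = y) ->
  exists2 Phi : Pt k n -> Pt k n, automorphism v Phi & forall y, Phi (pt a y) = pt a (T y).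
Proof.
move=> hT hT' TK T'K.
have lift x : exists y, isPoint v x -> x = pt a y.
  have [/(point_lift hc) [y ->]|hn] := classic (isPoint v x); first by exists y.
  by exists (fun _ => 0).
have [L hL] := choice _ lift.
have rep (S : ('I_n -> k) -> 'I_n -> k) : equivariant S -> forall m, exists s : seq (k * 'rV[int]_n),
    (forall p, p \in s -> inDual v p.2) /\
    forall y, pt a (S y) m = \sum_(p <- s) p.1 * pt a y p.2.
  move=> hS m; have [hm|hm] := boolP (dualb a m); last first.
    by exists [::]; split=> // y; rewrite /pt (negPf hm) big_nil.
  have dm := elimT (dualP hc m) hm.
  have [|s [hs e]] := @semi_invariant_regular (fun y => mon (degs a m) (S y)).
    by apply: (semi_comp hS); apply: semi_degs.
  by exists s; split=> // y; rewrite (ptE hc) // e.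
(* Independence of the chosen lift: by [rep], the point [pt a (S y)] depends on [y] only through
   [pt a y]. *)
have PhiE S : equivariant S -> forall y, pt a (S (L (pt a y))) = pt a (S y).
  move=> hS y; apply: functional_extensionality => m; have [s [_ e]] := rep S hS m.
  by rewrite !e -(hL _ (pt_isPoint hc y)).
have mor S : equivariant S -> morphism v (fun x => pt a (S (L x))).
  move=> hS; split=> [x _|m]; first exact: (pt_isPoint hc).
  have [s [hs e]] := rep S hS m; exists s; split=> // x hx.
  by rewrite e -(hL _ hx).
exists (fun x => pt a (T (L x))); last exact: PhiE.
split; first exact: mor.
exists (fun x => pt a (T' (L x))); split; first exact: mor.
split=> x hx; first by rewrite PhiE // TK -hL.
by rewrite PhiE // T'K -hL.
Qed.

End SemiInvariants.

(** * Moving curves by equivariant automorphisms *)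

Section Curves.
Variables (k : closedFieldType) (hchar : [pchar k] =i pred0).
Variables (n : nat) (v : 'I_n -> 'rV[int]_n) (d : nat)
  (a : 'rV[int]_n -> 'I_n -> int) (dl : 'I_n -> 'rV[int]_n).
Hypothesis hc : coordinates v d a dl.
Implicit Types (y : 'I_n -> k) (f g : 'I_n -> {poly k}) (p q r z h : {poly k}) (t : k).

Let aD := coordD hc.
Let hd := coord_gt1 hc.
Local Notation semi := (@semi k n a).
Local Notation cong := (cong a).
Local Notation equivariant := (@equivariant k n a).
Local Notation pow_separates := (pow_separates d).

Definition eval f t : 'I_n -> k := fun i => (f i).[t].

(* Restrictions to the curve [f] of the semi-invariants of degree [b] in the
   variables of [J]. *)
Definition restr J b f p := exists2 Q, semi J b Q & forall t, p.[t] = Q (eval f t).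

Definition inv_restr (J : pred 'I_n) := restr J (fun=> 0).

Lemma eval_upd f i h t : eval (upd f i h) t = upd (eval f t) i h.[t].
Proof. by apply: functional_extensionality => j; rewrite /eval /upd; case: ifP. Qed.

Lemma semi_poly J b f Q : semi J b Q -> exists p, forall t, p.[t] = Q (eval f t).
Proof.
elim=> [Q0 h|Q0 Q1 c al _ [p hp] hJ hal e]; first by exists 0 => t; rewrite h horner0.
exists (p + c *: \prod_i f i ^+ al i) => t; rewrite e -hp !hornerE horner_prod.
by congr (_ + _ * _); apply: eq_bigr => i _; rewrite horner_exp.
Qed.

Lemma restr_mon (J : pred 'I_n) b f al : (forall i, ~~ J i -> al i = 0%N) ->
  cong (zdeg al) b -> restr J b f (\prod_i f i ^+ al i).
Proof.
move=> hJ hb; exists (mon al); first exact: semi_mon.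
by move=> t; rewrite horner_prod; apply: eq_bigr => i _; rewrite horner_exp.
Qed.

Lemma restrL J b f c p q : restr J b f p -> restr J b f q -> restr J b f (c *: p + q).
Proof.
move=> [Q hQ e] [Q' hQ' e']; exists (fun y => c * Q y + Q' y).
  by apply: semiD => //; apply: (semiZ hc).
by move=> t; rewrite !hornerE e e'.
Qed.

Lemma restrM J b b' f p q : restr J b f p -> restr J b' f q ->
  restr J (fun i => b i + b' i) f (p * q).
Proof.
move=> [Q hQ e] [Q' hQ' e']; exists (fun y => Q y * Q' y); first exact: (semiM hc).
by move=> t; rewrite hornerM e e'.
Qed.

Lemma restr_cong J b b' f p : cong b b' -> restr J b f p -> restr J b' f p.
Proof. by move=> hb [Q hQ e]; exists Q => //; apply: (semi_cong hc) hQ. Qed.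

Lemma restrX J b f p e : restr J b f p -> restr J (fun i => b i *+ e) f (p ^+ e).
Proof.
move=> [Q hQ h]; exists (fun y => Q y ^+ e); first exact: (semiX hc).
by move=> t; rewrite horner_exp h.
Qed.

Lemma restr_invM J b f p q : inv_restr J f p -> restr J b f q -> restr J b f (p * q).
Proof.
move=> hp hq; apply: (restr_cong _ (restrM hp hq)).
by apply: (cong_eq hc) => i; rewrite add0r.
Qed.

Lemma inv_restr_subalgebra J f : subalgebra (inv_restr J f).
Proof.
split; [|by move=> c p q; apply: restrL|by move=> p q; apply: restr_invM].
by exists (fun _ => 1); [exact: (semiC hc)|move=> t; rewrite hornerC].
Qed.

Lemma restr_var (J : pred 'I_n) f i : J i -> restr J (unitw i) f (f i).
Proof. by move=> hi; exists (fun y => y i) => //; apply: (semi_var k hc). Qed.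

Lemma unitw_d i : cong (fun j => unitw i j *+ d) (fun=> 0).
Proof.
exists (dl i) => j; rewrite add0r (coord_dl hc) /unitw eq_sym.
by case: eqP => _; rewrite ?mul0rn ?mulr0n ?mulr1n // natz.
Qed.

Lemma inv_restr_pow (J : pred 'I_n) f i : J i -> inv_restr J f (f i ^+ d).
Proof. by move=> hi; apply: restr_cong (unitw_d i) (restrX d (restr_var f hi)). Qed.

Lemma restr_sub (J J' : pred 'I_n) b f p : (forall i, J i -> J' i) ->
  restr J b f p -> restr J' b f p.
Proof. by move=> sJ [Q hQ e]; exists Q => //; apply: semi_sub hQ. Qed.

Lemma restr_local (J : pred 'I_n) b f g p : (forall i, J i -> f i = g i) ->
  restr J b f p -> restr J b g p.
Proof.
move=> h [Q hQ e]; exists Q => // t; rewrite e; apply: semi_local hQ _ => i hi.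
by rewrite /eval h.
Qed.

Definition curve_equiv f g := exists T T', [/\ equivariant T, equivariant T',
  forall y, T' (T y) = y, forall y, T (T' y) = y & forall t, T (eval f t) = eval g t].

Lemma curve_equiv_refl f : curve_equiv f f.
Proof. by exists id, id; split=> //; exact: (equivariant_id k hc). Qed.

Lemma curve_equiv_trans f g g' : curve_equiv f g -> curve_equiv g g' -> curve_equiv f g'.
Proof.
move=> [T [T' [hT hT' K K' e]]] [S [S' [hS hS' L L' e']]].
exists (fun y => S (T y)), (fun y => T' (S' y)); split.
- exact: (equivariant_comp hc).
- exact: (equivariant_comp hc).
- by move=> y; rewrite L K.
- by move=> y; rewrite K' L'.
- by move=> t; rewrite e e'.
Qed.

Lemma curve_equiv_sym f g : curve_equiv f g -> curve_equiv g f.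
Proof.
move=> [T [T' [hT hT' K K' e]]]; exists T', T; split=> // t.
by rewrite -e K.
Qed.

Lemma curve_equiv_ext f g : (forall i, f i = g i) -> curve_equiv f g.
Proof.
by move=> h; have -> : f = g; [apply: functional_extensionality|exact: curve_equiv_refl].
Qed.

Lemma shear f i p : restr (predC1 i) (unitw i) f p -> curve_equiv f (upd f i (f i + p)).
Proof.
move=> [Q hQ e]; have hQ' : semi predT (unitw i) Q by apply: semi_sub hQ.
have Qu y c : Q (upd y i c) = Q y.
  by apply: semi_local hQ _ => j /negPf hj; rewrite /upd hj.
have eqv c : equivariant (fun y => upd y i (y i + c * Q y)).
  move=> j; have [->|ji] := eqVneq j i.
    apply: (semi_ext (Q := fun y => y i + c * Q y)) => [|y]; last by rewrite /upd eqxx.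
    by apply: semiD; [exact: (semi_var k hc)|exact: (semiZ hc)].
  apply: (semi_ext (Q := fun y => y j)) => [|y]; last by rewrite /upd (negPf ji).
  exact: (semi_var k hc).
exists (fun y => upd y i (y i + 1 * Q y)), (fun y => upd y i (y i + -1 * Q y)).
split=> // [y|y|t]; try by apply: functional_extensionality => j;
  rewrite Qu /upd eqxx; case: eqP => // ->; ring.
by rewrite eval_upd hornerD e mul1r.
Qed.

(** What remains upstairs of the two assumptions on the curve: invariants restrict onto $k[t]$
    because it is closed and isomorphic to the line; every weight occurs at every point because it
    lies in the regular locus, where $G$ acts freely. *)
Definition admissible f := inv_restr predT f 'X /\
  forall t b, exists2 Q, semi predT b Q & Q (eval f t) != 0.

Lemma admissible_equiv f g : curve_equiv f g -> admissible f -> admissible g.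
Proof.
move=> [T [T' [hT hT' K K' e]]] [[Q hQ eQ] hu].
have e' t : eval f t = T' (eval g t) by rewrite -e K.
split=> [|t b].
  by exists (fun y => Q (T' y)); [exact: (semi_comp hc)|move=> t; rewrite eQ e'].
have [R hR nR] := hu t b; exists (fun y => R (T' y)); first exact: (semi_comp hc).
by rewrite -e'.
Qed.

Definition coprime_family f := (forall i, f i != 0) /\
  (forall i j t, i != j -> root (f i) t -> ~~ root (f j) t).

Lemma make_coprime f : admissible f -> exists2 g, curve_equiv f g & coprime_family g.
Proof.
move=> hf.
suff H (s : seq 'I_n) : exists2 g, curve_equiv f g & forall i, i \in s ->
    g i != 0 /\ forall j t, j != i -> g j != 0 -> root (g i) t -> ~~ root (g j) t.
  have [g fg hg] := H (enum 'I_n); exists g => //.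
  split=> [i|i j t ij]; first by have [] := hg i (mem_enum _ _).
  have [gj _] := hg j (mem_enum _ _); have [_ hi] := hg i (mem_enum _ _).
  by apply: hi => //; rewrite eq_sym.
elim: s => [|i s [g fg hg]]; first by exists f => //; exact: curve_equiv_refl.
have [_ hu] := admissible_equiv fg hf.
(* The factor ['X] guarantees a root, so that the new [i]-th coordinate is not the zero
   polynomial. *)
pose z := 'X * \prod_(j | (j != i) && (g j != 0)) g j.
have z0 : z != 0.
  by rewrite mulf_neq0 ?polyX_eq0 //; apply/prodf_neq0 => j /andP [].
have [rs zE] := closed_field_poly_normal z.
have [||x p q|x hx|p Vp hp] := @generic_choice k _ (restr (predC1 i) (unitw i) g)
    (fun u p => (g i + p).[u]) rs.
- by exists 0; exists (fun _ => 0); [exact: semi0|move=> t; rewrite horner0].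
- by move=> c p q; apply: restrL.
- by exists (q.[x] *: 'X + (g i + p).[x]%:P) => c; rewrite !(hornerD, hornerZ, hornerX, hornerC); ring.
- have [gx|gx] := eqVneq (g i).[x] 0; last first.
    exists 0; last by rewrite addr0.
    by exists (fun _ => 0); [exact: semi0|move=> t; rewrite horner0].
  have [Q hQ nQ] := hu x (unitw i).
  (* Since [g i] vanishes at [x], the monomials involving the [i]-th variable contribute nothing
     there, and deleting them keeps the value nonzero. *)
  have hQ' := semi_delete i hQ; have [p hp] := semi_poly g hQ'.
  exists p; first by exists (fun y => Q (upd y i 0)).
  rewrite hornerD gx add0r hp; suff -> : upd (eval g x) i 0 = eval g x by [].
  by apply: functional_extensionality => j; rewrite /upd; case: eqP => // ->; rewrite /eval gx.
have hz t : root z t -> (g i + p).[t] != 0.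
  by move=> ht; apply: hp; move: ht; rewrite zE rootZ ?lead_coef_eq0 // root_prod_XsubC.
have hj j t : j != i -> g j != 0 -> root (g j) t -> (g i + p).[t] != 0.
  move=> ji gj rj; apply: hz; rewrite /z rootM (bigD1 j) /=; last by rewrite ji.
  by rewrite rootM rj orbT.
exists (upd g i (g i + p)); first exact: curve_equiv_trans fg (shear Vp).
move=> l; have [-> _|li] := eqVneq l i.
  rewrite /upd eqxx; split.
    by apply: contraNneq (hz 0 _) => [->|]; rewrite ?horner0 // rootM rootX eqxx.
  move=> j t ji; rewrite (negPf ji) => gj; apply: contraL => rj.
  exact: (hj j).
rewrite inE (negPf li) /= => /hg [gl hl]; rewrite /upd (negPf li); split=> // j t jl.
case: (eqVneq j i) => [_ _ rl|_]; last exact: (hl j t jl).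
by apply: (hj l).
Qed.

Hypothesis hpair : forall i j, i != j -> exists m, a m i = 1 /\ a m j = 0.
Hypothesis hn : (4 <= n)%N.

Lemma exists_other (i : 'I_n) : exists j, j != i.
Proof.
have [n0 n1] : (0 < n)%N /\ (1 < n)%N by split; apply: leq_trans hn.
have [->|i0] := eqVneq i (Ordinal n0); first by exists (Ordinal n1).
by exists (Ordinal n0); rewrite eq_sym.
Qed.

Lemma restr_unit f i :
  (forall j l t, j != i -> l != i -> j != l -> root (f j) t -> ~~ root (f l) t) ->
  forall t b, exists2 q, restr (predC1 i) b f q & q.[t] != 0.
Proof.
move=> hf t b.
have [j ji hj] : exists2 j, j != i & forall l, l != i -> l != j -> ~~ root (f l) t.
  have [[j ji rj]|hno] := classic (exists2 j, j != i & root (f j) t).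
    by exists j => // l li lj; apply: (hf j) => //; rewrite eq_sym.
  have [j ji] := exists_other i; exists j => // l li _.
  by apply/negP => rl; apply: hno; exists l.
have [l hl|al al0 hal] := @weight_off_face _ _ _ _ _ hc (pred2 i j) _ b.
  have := hl => /orP [/eqP ->|/eqP ->].
    have [|m [m1 m0]] := hpair (i := i) (j := j); first by rewrite eq_sym.
    exists m => u /orP [/eqP ->|/eqP ->]; first by rewrite eqxx.
    by rewrite m0 (negPf ji).
  have [m [m1 m0]] := hpair ji; exists m => u /orP [/eqP ->|/eqP ->]; last by rewrite eqxx.
  by rewrite m0 eq_sym (negPf ji).
exists (\prod_l f l ^+ al l).
  apply: restr_mon => // l; rewrite negbK => /eqP ->; apply: al0.
  by rewrite /= eqxx.
rewrite horner_prod; apply/prodf_neq0 => l _; rewrite horner_exp.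
have [l0|l0] := boolP (pred2 i j l); first by rewrite al0 // expr0 oner_neq0.
by rewrite expf_neq0 //; move: l0; rewrite negb_or => /andP [li lj]; apply: hj.
Qed.

Lemma coprime_upd f i h : coprime_family f -> h != 0 ->
  (forall j t, j != i -> root (f j) t -> h.[t] != 0) -> coprime_family (upd f i h).
Proof.
move=> [f0 hf] h0 hh; split=> [j|j l t jl]; rewrite /upd; first by case: ifP.
case: (eqVneq j i) => [ji|ji]; case: (eqVneq l i) => [li|li].
- by move: jl; rewrite ji li eqxx.
- by apply: contraL => /(hh _ _ li).
- by move=> /(hh _ _ ji).
- exact: hf.
Qed.

(* If [f i] is proportional to [q] modulo [(X - s)(X - t)], every invariant
   monomial is congruent to one in which [f i] is replaced by [c q], hence to an
   invariant not involving the [i]-th variable. *)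
Lemma monomials_not_separating f i s t : admissible f ->
  (forall b, inv_restr (predC1 i) f b -> divdiff s t b = 0) ->
  forall c q, restr (predC1 i) (unitw i) f q ->
  ('X - s%:P) * ('X - t%:P) %| f i - c *: q -> False.
Proof.
move=> [[Q hQ eQ] _] hD c q Vq hdvd.
suff [p hp p0] : exists2 p, (forall u, p.[u] = Q (eval f u)) & divdiff s t p = 0.
  have e : 'X = p by apply: poly_fun_inj => u; rewrite hp eQ.
  by move: p0; rewrite -e divdiffX => /eqP; rewrite oner_eq0.
elim: hQ {eQ} => [Q0 h|Q0 Q1 c' al _ [p hp p0] _ hal e].
  by exists 0 => [u|]; rewrite ?h ?horner0 // -(scale0r 0) divdiffZ mul0r.
exists (c' *: \prod_j f j ^+ al j + p) => [u|].
  rewrite hornerD hornerZ horner_prod e hp addrC; congr (_ + _ * _).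
  by apply: eq_bigr => j _; rewrite horner_exp.
rewrite divdiffD divdiffZ p0 addr0; suff -> : divdiff s t (\prod_j f j ^+ al j) = 0 by rewrite mulr0.
pose al' := upd al i 0%N; pose R := \prod_j f j ^+ al' j.
have -> : \prod_j f j ^+ al j = f i ^+ al i * R.
  rewrite (bigD1 i) //= /R [in RHS](bigD1 i) //= /al' /upd eqxx expr0 mul1r.
  by congr (_ * _); apply: eq_bigr => j /negPf ->.
rewrite (@divdiff_mod _ s t _ ((c *: q) ^+ al i * R)).
  rewrite exprZn -scalerAl divdiffZ hD ?mulr0 //.
  have hR : restr (predC1 i) (zdeg al') f R.
    apply: restr_mon; last exact: (congxx hc).
    by move=> j; rewrite negbK => /eqP ->; rewrite /al' /upd eqxx.
  apply: restr_cong (restrM (restrX (al i) Vq) hR).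
  apply: (cong_trans hc) hal; apply: (cong_eq hc) => j; rewrite /zdeg /al' /upd /unitw.
  by case: eqP => [->|_]; rewrite ?addr0 ?natz // mul0rn add0r.
by rewrite -mulrBl subrXX dvdp_mulr // dvdp_mulr.
Qed.

Lemma shear_separates f i z : admissible f -> coprime_family f -> z != 0 ->
  exists2 h, curve_equiv f (upd f i h) &
    coprime_family (upd f i h) /\ pow_separates h z.
Proof.
move=> hf cf z0; have [f0 hcf] := cf.
(* Separation at the zeros of the other coordinates keeps the family coprime; ['X] again excludes
   the zero polynomial. *)
pose z' := z * ('X * \prod_(j | j != i) f j).
have z'0 : z' != 0.
  by rewrite !mulf_neq0 ?polyX_eq0 //; apply/prodf_neq0 => j _.
have [rs zE] := closed_field_poly_normal z'.
have hu : forall t, exists2 q, restr (predC1 i) (unitw i) f q & q.[t] != 0.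
  by move=> t; apply: restr_unit => j l u _ _; apply: hcf.
have [||x p q|x hx|p Vp hp] := @generic_choice k _ (restr (predC1 i) (unitw i) f)
    (fun x p => divdiff x.1 x.2 ((f i + p) ^+ d)) [seq (s, t) | s <- rs, t <- rs].
- by exists 0; exists (fun _ => 0); [exact: semi0|move=> t; rewrite horner0].
- by move=> c p q; apply: restrL.
- have [P hP] := divdiff_pow_line_poly d x.1 x.2 (f i + p) q.
  by exists P => c; rewrite -hP addrCA.
- apply: (pow_separates_shift hchar hd (B := inv_restr (predC1 i) f)) => //.
  + exact: inv_restr_subalgebra.
  + by move=> c p q; apply: restrL.
  + by move=> b p; apply: restr_invM.
  + by move=> p Vp; apply: restr_cong (unitw_d i) (restrX d Vp).
  + exact: monomials_not_separating.
have hz : pow_separates (f i + p) z'.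
  move=> s t; rewrite zE !rootZ ?lead_coef_eq0 // !root_prod_XsubC => hs ht.
  by apply: (hp (s, t)); apply/allpairsP; exists (s, t).
exists (f i + p); first exact: shear.
split; last by apply: pow_separates_dvd hz; apply: dvdp_mulr.
have nr j t : j != i -> root (f j) t -> (f i + p).[t] != 0.
  move=> ji rj; apply: (pow_separates_nonroot hd hz).
  by rewrite /z' !rootM (bigD1 j) //= rootM rj !orbT.
apply: coprime_upd => //.
have r0 : root z' 0 by rewrite /z' !rootM rootX eqxx orbT.
by apply: contraNneq (pow_separates_nonroot hd hz r0) => ->; rewrite horner0.
Qed.

Lemma restr_full J f : inv_restr J f 'X -> forall p, inv_restr J f p.
Proof. exact: subalg_eq_all (inv_restr_subalgebra J f). Qed.

Lemma replace_coord f i h : coprime_family f -> inv_restr (predC1 i) f 'X ->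
  curve_equiv f (upd f i h).
Proof.
move=> [_ hf] hX; have -> : h = f i + (h - f i) by rewrite addrC subrK.
apply: shear; apply: (@ideal_full k (restr (predC1 i) (unitw i) f)).
- by move=> p q Vp Vq; rewrite -[p]scale1r; apply: restrL.
- by move=> r p; apply: restr_invM; apply: restr_full hX _.
- by move=> t; apply: restr_unit => j l u _ _; apply: hf.
Qed.

Lemma pair_conductor f i j : (1 < size (f j))%N -> pow_separates (f i) (f j) ->
  exists2 q, q != 0 & forall r, inv_restr (pred2 i j) f (q * r).
Proof.
move=> sj hij; apply: (@pow_separates_conductor k d hd _ (f i) (f j)) => //.
- exact: inv_restr_subalgebra.
- by apply: inv_restr_pow; rewrite /= eqxx.
- by apply: inv_restr_pow; rewrite /= eqxx orbT.
Qed.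

Lemma triple_full f (J J' : pred 'I_n) i q : (forall j, J j -> J' j) -> J' i ->
  q != 0 -> (forall r, inv_restr J f (q * r)) -> pow_separates (f i) q ->
  inv_restr J' f 'X.
Proof.
move=> sJ hi q0 hq hs; apply: (@pow_separates_full k d _ (f i) q) => //.
- exact: inv_restr_subalgebra.
- exact: inv_restr_pow.
- by move=> r; apply: (restr_sub sJ); exact: hq.
Qed.

Lemma replace_step (J : pred 'I_n) f i h : coprime_family f -> ~~ J i ->
  inv_restr J f 'X -> h != 0 -> (forall j t, root (f j) t -> h.[t] != 0) ->
  curve_equiv f (upd f i h) /\ coprime_family (upd f i h).
Proof.
move=> cf Ji hX h0 hh; split; last by apply: coprime_upd => // j t _; apply: hh.
apply: replace_coord => //; apply: restr_sub hX => j hj /=.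
by apply: contraNneq Ji => <-.
Qed.

Lemma replace_separating (J : pred 'I_n) f i h q : coprime_family f -> ~~ J i ->
  inv_restr J f 'X -> (1 < size h)%N -> pow_separates h (q * \prod_j f j) ->
  [/\ curve_equiv f (upd f i h), coprime_family (upd f i h),
    pow_separates h q & forall j, pow_separates h (f j)].
Proof.
move=> cf Ji hX sh hs.
have h0 : h != 0 by rewrite -size_poly_gt0; apply: ltnW.
have hj j : f j %| q * \prod_j f j by rewrite (bigD1 j) //= mulrCA dvdp_mulr.
have [|H1 H2] := replace_step cf Ji hX h0.
  by move=> j t rt; apply: (pow_separates_nonroot hd hs); apply: dvdp_root (hj j) rt.
split=> // [|j]; apply: pow_separates_dvd hs => //; exact: dvdp_mulr.
Qed.

(** * Normal forms of curves *)

Variables i1 i2 i3 i4 : 'I_n.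
Hypothesis hu : uniq [:: i1; i2; i3; i4].

Let neqs : [/\ (i1 == i2) = false, (i1 == i3) = false & (i1 == i4) = false] /\
  [/\ (i2 == i3) = false, (i2 == i4) = false & (i3 == i4) = false].
Proof.
move: hu; rewrite /= !inE !negb_or.
by move=> /and4P [/and3P [/negPf -> /negPf -> /negPf ->] /andP [/negPf -> /negPf ->] /negPf -> _].
Qed.

(** The ideal attached to the pair [i1], [i2] outlives a change of the fourth coordinate, which can
    then take over from the third; nonconstancy of [f i1] allows pairing it afterwards with the new
    fourth coordinate. *)
Definition in_good_position f := [/\ coprime_family f, (1 < size (f i1))%N,
  exists2 q, q != 0 & forall r, inv_restr (pred2 i1 i2) f (q * r) &
  inv_restr (pred3 i1 i2 i3) f 'X].

Lemma move_to_good_position f : admissible f -> exists2 g, curve_equiv f g & in_good_position g.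
Proof.
move=> hf; have [[n12 n13 n14] [n23 n24 n34]] := neqs.
have X0 : ('X : {poly k}) != 0 by rewrite polyX_eq0.
have rX : root ('X : {poly k}) 0 by rewrite rootX.
have [f0 e0 c0] := make_coprime hf; have a0 := admissible_equiv e0 hf.
have [h2 e1 [c1 s1]] := shear_separates i2 a0 c0 X0.
set f1 := upd f0 i2 h2 in e1 c1; have a1 := admissible_equiv e1 a0.
have sz2 := pow_separates_size s1 rX.
have h20 : h2 != 0 by rewrite -size_poly_gt0; apply: ltnW.
have [h1 e2 [c2 s2]] := shear_separates i1 a1 c1 (mulf_neq0 X0 h20).
set f2 := upd f1 i1 h1 in e2 c2; have a2 := admissible_equiv e2 a1.
have sz1 : (1 < size h1)%N by apply: (pow_separates_size s2 (s := 0)); rewrite rootM rX.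
have f2E : f2 i1 = h1 /\ f2 i2 = h2 by rewrite /f2 /f1 /upd !eqxx eq_sym n12.
have [q q0 hq] : exists2 q, q != 0 & forall r, inv_restr (pred2 i1 i2) f2 (q * r).
  apply: pair_conductor; rewrite ?f2E.1 f2E.2 //.
  by apply: pow_separates_dvd s2; apply: dvdp_mull.
have [h3 e3 [c3 s3]] := shear_separates i3 a2 c2 q0.
set f3 := upd f2 i3 h3 in e3 c3.
have hq3 r : inv_restr (pred2 i1 i2) f3 (q * r).
  apply: restr_local (hq r) => j /= hj; rewrite /f3 /upd.
  by case: (eqVneq j i3) hj => [->|] //; rewrite ![i3 == _]eq_sym n13 n23.
exists f3; first exact: curve_equiv_trans e0 (curve_equiv_trans e1 (curve_equiv_trans e2 e3)).
split=> //; first by rewrite /f3 /upd n13 f2E.1.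
  by exists q.
apply: (@triple_full f3 (pred2 i1 i2) _ i3 q) => //.
- by move=> j /orP [] /eqP ->; rewrite /= eqxx ?orbT.
- by rewrite /= eqxx !orbT.
- by rewrite /f3 /upd eqxx.
Qed.

Lemma flatten_coords f : coprime_family f -> inv_restr (pred3 i1 i2 i3) f 'X ->
  let g j := if pred3 i1 i2 i3 j then f j else 1 in curve_equiv f g /\ coprime_family g.
Proof.
move=> cf hX g.
pose fl (s : seq 'I_n) j := if (j \in s) && ~~ pred3 i1 i2 i3 j then 1 else f j.
have gE : g = fl (enum 'I_n).
  apply: functional_extensionality => j; rewrite /g /fl mem_enum.
  by rewrite andTb; case: ifP.
rewrite gE; elim: (enum _) => [|i s [e c]]; first by split; [exact: curve_equiv_refl|].
have [hi|hi] := boolP (pred3 i1 i2 i3 i).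
  have -> : fl (i :: s) = fl s; last by [].
  apply: functional_extensionality => j; rewrite /fl inE.
  by case: eqP => // ->; rewrite hi !andbF.
have -> : fl (i :: s) = upd (fl s) i 1.
  apply: functional_extensionality => j; rewrite /fl /upd inE.
  by case: eqP => // ->; rewrite hi.
have [|||e' c'] := @replace_step _ (fl s) i 1 c hi.
- by apply: restr_local hX => j hj; rewrite /fl hj andbF.
- exact: oner_neq0.
- by move=> j t _; rewrite hornerC oner_neq0.
by split=> //; apply: curve_equiv_trans e e'.
Qed.

Definition normal_form (h2 h3 h4 : {poly k}) j :=
  if j == i2 then h2 else if j == i3 then h3 else if j == i4 then h4 else 1.

(* The exceptional polynomials [z4], [z3], [z2] only depend on data chosen
   earlier, so that two curves admit a common normal form. *)
Lemma move_to_normal_form f : in_good_position f ->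
  exists2 z4, z4 != 0 & forall h4, (1 < size h4)%N -> pow_separates h4 z4 ->
  exists2 z3, z3 != 0 & forall h3, (1 < size h3)%N -> pow_separates h3 z3 ->
  exists2 z2, z2 != 0 & forall h2, (1 < size h2)%N -> pow_separates h2 z2 ->
  curve_equiv f (normal_form h2 h3 h4).
Proof.
have [[n12 n13 n14] [n23 n24 n34]] := neqs.
have [[m12 m13 m14] [m23 m24 m34]] : [/\ (i2 == i1) = false, (i3 == i1) = false & (i4 == i1) = false] /\
  [/\ (i3 == i2) = false, (i4 == i2) = false & (i4 == i3) = false] by split; split; rewrite eq_sym.
move=> [cf s1 [q12 q0 hq12] hX].
have [] := flatten_coords cf hX; set g5 := fun j => _ => e5 c5.
have g5E j : pred3 i1 i2 i3 j -> f j = g5 j by rewrite /g5 => ->.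
have hX5 : inv_restr (pred3 i1 i2 i3) g5 'X by apply: restr_local hX.
have prod0 g : coprime_family g -> \prod_j g j != 0.
  by move=> [g0 _]; apply/prodf_neq0 => j _.
exists (q12 * \prod_j g5 j); first by rewrite mulf_neq0 ?prod0.
move=> h4 s4 hs4; have ni4 : ~~ pred3 i1 i2 i3 i4 by rewrite /= m14 m24 m34.
have [e4 c4 hs4q hs4f] := replace_separating c5 ni4 hX5 s4 hs4.
set g4 := upd g5 i4 h4 in e4 c4.
(* The generating triple rotates from here on: $(i_1,i_2,i_4)$ frees $i_3$, then $(i_1,i_3,i_4)$
   frees $i_2$, then $(i_2,i_3,i_4)$ frees $i_1$. Each new polynomial separates the roots of the
   conductor of the pair that is kept. *)
have hX4 : inv_restr (pred3 i1 i2 i4) g4 'X.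
  apply: (@triple_full g4 (pred2 i1 i2) _ i4 q12) => //.
  - by move=> j /orP [] /eqP ->; rewrite /= eqxx ?orbT.
  - by rewrite /= eqxx !orbT.
  - move=> r; apply: restr_local (hq12 r) => j hj; rewrite /g4 /upd.
    by case/orP: hj => /eqP ->; rewrite ?n14 ?n24 g5E //= eqxx ?orbT.
  - by rewrite /g4 /upd eqxx.
have [q14 q140 hq14] : exists2 q, q != 0 & forall r, inv_restr (pred2 i4 i1) g4 (q * r).
  have g41 : g4 i1 = f i1 by rewrite /g4 /upd n14 g5E //= eqxx.
  apply: pair_conductor; rewrite g41 //; rewrite /g4 /upd eqxx.
  by rewrite g5E ?hs4f //= eqxx.
exists (q14 * \prod_j g4 j); first by rewrite mulf_neq0 ?prod0.
move=> h3 s3 hs3; have ni3 : ~~ pred3 i1 i2 i4 i3 by rewrite /= m13 m23 n34.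
have [e3 c3 hs3q hs3f] := replace_separating c4 ni3 hX4 s3 hs3.
set g3 := upd g4 i3 h3 in e3 c3.
have g34 : g3 i4 = h4 by rewrite /g3 /upd m34 /g4 /upd eqxx.
have hX3 : inv_restr (pred3 i1 i3 i4) g3 'X.
  apply: (@triple_full g3 (pred2 i4 i1) _ i3 q14) => //.
  - by move=> j /orP [] /eqP ->; rewrite /= eqxx ?orbT.
  - by rewrite /= eqxx !orbT.
  - move=> r; apply: restr_local (hq14 r) => j hj; rewrite /g3 /upd.
    by case/orP: hj => /eqP ->; rewrite ?m34 ?n13.
  - by rewrite /g3 /upd eqxx.
have [q34 q340 hq34] : exists2 q, q != 0 & forall r, inv_restr (pred2 i3 i4) g3 (q * r).
  apply: pair_conductor; rewrite g34 //; rewrite /g3 /upd eqxx.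
  by have := hs3f i4; rewrite /g4 /upd eqxx.
exists (q34 * \prod_j g3 j); first by rewrite mulf_neq0 ?prod0.
move=> h2 s2 hs2; have ni2 : ~~ pred3 i1 i3 i4 i2 by rewrite /= m12 n23 n24.
have [e2 c2 hs2q hs2f] := replace_separating c3 ni2 hX3 s2 hs2.
set g2 := upd g3 i2 h2 in e2 c2.
have hX2 : inv_restr (pred3 i2 i3 i4) g2 'X.
  apply: (@triple_full g2 (pred2 i3 i4) _ i2 q34) => //.
  - by move=> j /orP [] /eqP ->; rewrite /= eqxx ?orbT.
  - by rewrite /= eqxx.
  - move=> r; apply: restr_local (hq34 r) => j hj; rewrite /g2 /upd.
    by case/orP: hj => /eqP ->; rewrite ?m24 ?m23.
  - by rewrite /g2 /upd eqxx.
have ni1 : ~~ pred3 i2 i3 i4 i1 by rewrite /= n12 n13 n14.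
have [||e1 _] := @replace_step _ g2 i1 1 c2 ni1 hX2.
- exact: oner_neq0.
- by move=> j t _; rewrite hornerC oner_neq0.
apply: (curve_equiv_trans e5); apply: (curve_equiv_trans e4).
apply: (curve_equiv_trans e3); apply: (curve_equiv_trans e2); apply: (curve_equiv_trans e1).
apply: curve_equiv_ext => j; rewrite /normal_form /upd.
have [->|j1] := eqVneq j i1; first by rewrite n12 n13 n14.
rewrite /g2 /upd; have [//|j2] := eqVneq j i2.
rewrite /g3 /upd; have [//|j3] := eqVneq j i3.
rewrite /g4 /upd; have [//|j4] := eqVneq j i4.
by rewrite /g5 /= (negPf j1) (negPf j2) (negPf j3).
Qed.

Lemma admissible_curves_equiv f g : admissible f -> admissible g -> curve_equiv f g.
Proof.
move=> /move_to_good_position [f' ef /move_to_normal_form [z4 z40 F4]].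
move=> /move_to_good_position [g' eg /move_to_normal_form [w4 w40 G4]].
have pick z w : z != 0 -> w != 0 -> exists h, [/\ (1 < size h)%N, pow_separates h z & pow_separates h w].
  move=> z0 w0; have [h sh hs] := pow_separates_exists hchar hd (mulf_neq0 z0 w0).
  by exists h; split=> //; apply: pow_separates_dvd hs; [apply: dvdp_mulr|apply: dvdp_mull].
have [h4 [s4 f4 g4]] := pick _ _ z40 w40.
have [z3 z30 F3] := F4 _ s4 f4; have [w3 w30 G3] := G4 _ s4 g4.
have [h3 [s3 f3 g3]] := pick _ _ z30 w30.
have [z2 z20 F2] := F3 _ s3 f3; have [w2 w20 G2] := G3 _ s3 g3.
have [h2 [s2 f2 g2]] := pick _ _ z20 w20.
apply: (curve_equiv_trans ef); apply: (curve_equiv_trans (F2 _ s2 f2)).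
apply: curve_equiv_sym; apply: (curve_equiv_trans eg); exact: G2.
Qed.

End Curves.

(** * Lifting curves in the regular locus to affine space *)

Section CurveLift.
Variables (k : closedFieldType) (hchar : [pchar k] =i pred0).
Variables (n : nat) (v : 'I_n -> 'rV[int]_n) (d : nat)
  (a : 'rV[int]_n -> 'I_n -> int) (dl : 'I_n -> 'rV[int]_n).
Hypothesis hc : coordinates v d a dl.
Implicit Types (m : 'rV[int]_n) (y : 'I_n -> k) (t : k).

Lemma mup_exp (p : {poly k}) u e : p != 0 -> mup u (p ^+ e) = (e * mup u p)%N.
Proof.
move=> p0; elim: e => [|e IH]; first by rewrite mupNroot // expr0 root1.
by rewrite exprS mupM ?expf_neq0 // IH mulSn.
Qed.

Variable gamma : k -> Pt k n.
Hypotheses (hpt : forall t, isPoint v (gamma t))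
  (hpoly : forall m, exists p : {poly k}, forall t, gamma t m = p.[t])
  (hreg : forall t, regular_point v (gamma t)).

(* Over a regular point the vanishing order of each semi-invariant
   coordinate is integral, so the [d]-th powers [gamma (dl i)] have
   polynomial [d]-th roots. *)
Lemma curve_lift : exists f : 'I_n -> {poly k}, forall t, gamma t = pt a (eval f t).
Proof.
have d0 := coord_gt0 hc; have [P hP] := choice _ hpoly.
have PM m m' : inDual v m -> inDual v m' -> P (m + m') = P m * P m'.
  move=> h h'; apply: poly_fun_inj => t; rewrite hornerM -!hP.
  by have [_ -> ] := hpt t.
have Pexp m : inDual v m -> P m ^+ d = \prod_i P (dl i) ^+ degs a m i.
  move=> h; apply: poly_fun_inj => t; rewrite horner_exp horner_prod -hP (point_exp hc) //.
  by apply: eq_bigr => i _; rewrite horner_exp hP.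
have Pmup i u : P (dl i) != 0 -> (d %| mup u (P (dl i)))%N.
  move=> P0; have [ru|nr] := boolP (root (P (dl i)) u); last by rewrite mupNroot.
  have [y ey] := point_lift hc (hpt u).
  have yE j : (P (dl j)).[u] = y j ^+ d by rewrite -hP ey (pt_dl hc).
  have yi : y i = 0.
    by move/rootP: ru; rewrite yE => /eqP; rewrite expf_eq0 d0 => /eqP.
  have hr : regular_point v (pt a y) by rewrite -ey.
  (* This character has exponent $1$ at [i] and $0$ at the other coordinates vanishing over [u], so
     its [d]-th power is [P (dl i)] times a factor nonzero at [u]. *)
  have [m hm] := regular_primitive hchar hc hr yi.
  have [|m' dm' em'] := @dual_shift _ _ _ _ _ hc (fun j => y j == 0) m.
    by move=> j /eqP yj; rewrite hm //; case: eqP.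
  have degm j : y j = 0 -> degs a m' j = (j == i).
    by move=> yj; rewrite /degs em' ?hm ?yj //; case: eqP.
  have := Pexp _ dm'; rewrite (bigD1 i) //= degm // eqxx expr1.
  set R := \prod_(j | _) _ => eR.
  have nR : ~~ root R u.
    rewrite rootE horner_prod; apply/prodf_neq0 => j ji; rewrite horner_exp yE.
    have [yj|yj] := eqVneq (y j) 0; first by rewrite degm // (negPf ji) expr0 oner_neq0.
    by rewrite !expf_neq0.
  have R0 : R != 0 by apply: contraNneq nR => ->; rewrite root0.
  have Pm0 : P m' != 0.
    have : P m' ^+ d != 0 by rewrite eR mulf_neq0.
    by rewrite expf_eq0 d0.
  by have := congr1 (mup u) eR; rewrite mupMl // mup_exp // => <-; apply: dvdn_mulr.
have hroot i : exists h : {poly k}, h \is monic /\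
    (P (dl i) != 0 -> P (dl i) = lead_coef (P (dl i)) *: h ^+ d).
  have [P0|P0] := eqVneq (P (dl i)) 0; first by exists 1; rewrite monic1.
  have [h mh eh] := monic_nth_root d0 P0 (fun u => Pmup i u P0).
  by exists h.
have [h hh] := choice _ hroot.
(* The roots [h i] are monic, and the constants in front must be compatible with all characters at
   once. Leading coefficients are multiplicative, hence form a point of $X_\sigma$, and a lift of
   that point supplies the constants. *)
have hpsi : isPoint v (fun m => lead_coef (P m)).
  split=> [|m m' dm dm'|m dm].
  - have -> : P 0 = 1; last exact: lead_coef1.
    by apply: poly_fun_inj => t; rewrite -hP hornerC; case: (hpt t).
  - by rewrite PM // lead_coefM.
  - have -> : P m = 0; last exact: lead_coef0.
    by apply: poly_fun_inj => t; rewrite -hP horner0; case: (hpt t) => _ _ ->.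
have [y ey] := point_lift hc hpsi.
have PE m : inDual v m -> P m = lead_coef (P m) *: \prod_i h i ^+ degs a m i.
  move=> dm; have [->|Pm0] := eqVneq (P m) 0; first by rewrite lead_coef0 scale0r.
  have mh : \prod_i h i ^+ degs a m i \is monic.
    by apply: monic_prod => i _; apply: monic_exp; case: (hh i).
  apply: (monic_exp_inj (c := \prod_i lead_coef (P (dl i)) ^+ degs a m i) d0 mh).
  rewrite Pexp // -prodrXl -scaler_prod; apply: eq_bigr => i _.
  have [->|e0] := posnP (degs a m i); first by rewrite !expr0 expr1n scale1r.
  rewrite {1}(proj2 (hh i)); first by rewrite exprZn -!exprM mulnC.
  have : P m ^+ d != 0 by rewrite expf_neq0.
  rewrite Pexp // (bigD1 i) //= mulf_eq0 negb_or expf_eq0 e0.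
  by case/andP.
exists (fun i => y i *: h i) => t; apply: functional_extensionality => m.
have [dm|dm] := boolP (dualb a m); last first.
  by rewrite /pt (negPf dm); case: (hpt t) => _ _ -> //; apply/(dualP hc).
move/(dualP hc): dm => dm; rewrite (ptE hc) // hP PE // hornerZ horner_prod.
have -> : lead_coef (P m) = mon (degs a m) y by rewrite -(ptE hc) // -ey.
rewrite -big_split; apply: eq_bigr => i _.
by rewrite /eval hornerZ horner_exp exprMn.
Qed.

Hypothesis hinv : exists f, regular_fun v f /\ forall t, f (gamma t) = t.

Lemma curve_lift_admissible : exists2 f, admissible a f & forall t, gamma t = pt a (eval f t).
Proof.
have [f hf] := curve_lift; exists f => //; split.
  have [F [[s [hs hF]] FE]] := hinv.
  exists (fun y => \sum_(p <- s) p.1 * pt a y p.2); last first.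
    by move=> t; rewrite hornerX -[LHS]FE hF // hf.
  elim: s hs {hF} => [|p s IH] hs; first by apply: semi0 => y; rewrite big_nil.
  apply: (semi_ext (Q := fun y => p.1 * mon (degs a p.2) y + \sum_(q <- s) q.1 * pt a y q.2)).
    apply: semiD; last by apply: IH => q hq; apply: hs; rewrite inE hq orbT.
    by apply: (semiZ hc); apply: (semi_degs k hc) => //; apply: hs; rewrite mem_head.
  by move=> y; rewrite big_cons (ptE hc) //; apply: hs; rewrite mem_head.
move=> t b; have hr : regular_point v (pt a (eval f t)) by rewrite -hf.
have [i /eqP /(regular_primitive hchar hc hr) [m hm]|al al0 hal] :=
    @weight_off_face _ _ _ _ _ hc (fun i => eval f t i == 0) _ b.
  by exists m => j /eqP; apply: hm.
exists (mon al); first exact: semi_mon.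
rewrite mon_eq0; apply/existsPn => i; rewrite negb_and -leqNgt leqn0.
by have [/al0 ->|] := boolP (eval f t i == 0).
Qed.

End CurveLift.

(** * Regular functions along a curve *)

Section RegularFunctions.
Variables (k : closedFieldType) (n : nat) (v : 'I_n -> 'rV[int]_n).

Lemma regular_fun_sum (s : seq (k * 'rV[int]_n)) (G : 'rV[int]_n -> Pt k n -> k) :
  (forall m, regular_fun v (G m)) -> regular_fun v (fun x => \sum_(p <- s) p.1 * G p.2 x).
Proof.
move=> hG; elim: s => [|p s [s1 [h1 e1]]]; first by exists [::]; split=> // x _; rewrite !big_nil.
have [s2 [h2 e2]] := hG p.2.
exists ([seq (p.1 * q.1, q.2) | q <- s2] ++ s1); split=> [q|x hx].
  by rewrite mem_cat => /orP [/mapP [q' /h2 hq' ->]|/h1].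
rewrite big_cons big_cat e1 // big_map e2 // mulr_sumr; congr (_ + _).
by apply: eq_bigr => q _; rewrite mulrA.
Qed.

Lemma regular_fun_curve g (gamma : k -> Pt k n) : regular_fun v g ->
  (forall t, isPoint v (gamma t)) ->
  (forall m, exists p : {poly k}, forall t, gamma t m = p.[t]) ->
  exists p : {poly k}, forall t, g (gamma t) = p.[t].
Proof.
move=> [s [_ hs]] hpt hpoly; have [P hP] := choice _ hpoly.
exists (\sum_(q <- s) q.1 *: P q.2) => t; rewrite hs // horner_sum.
by apply: eq_bigr => q _; rewrite hornerZ hP.
Qed.

End RegularFunctions.

Theorem theorem5p3 (k : closedFieldType) (hchar : [pchar k] =i pred0)
  (n : nat) (v : 'I_n -> 'rV[int]_n)
  (hsimp : simplicial_full v) (hdim : (4 <= n)%N)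
  (hcodim : @smooth_in_codim2 k n v)
  (C C' : Pt k n -> Prop)
  (hC : smooth_polynomial_curve v C) (hC' : smooth_polynomial_curve v C')
  (hCreg : forall x, C x -> regular_point v x)
  (hC'reg : forall x, C' x -> regular_point v x)
  (phi : Pt k n -> Pt k n) (hphi : curve_iso v C C' phi) :
  exists Phi : Pt k n -> Pt k n,
    automorphism v Phi /\ forall x, C x -> Phi x = phi x.
Proof.
have [d [a [dl hc]]] := simplicial_coordinates hsimp.
have [gamma [gpt gpoly [F [[s [hs FE]] Fg]] gC]] := hC.
have [[phiC phireg] [psi [[psiC psireg] [psiK _]]]] := hphi.
have Cg t : C (gamma t) by apply/gC; exists t.
have [f hf fE] : exists2 f, admissible a f & forall t, gamma t = pt a (eval f t).
  apply: (curve_lift_admissible hchar hc) => // [t|]; first exact: hCreg.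
  by exists F; split=> //; exists s.
have [g hg gE] : exists2 g, admissible a g & forall t, phi (gamma t) = pt a (eval g t).
  have pt' t : isPoint v (phi (gamma t)) by case: (hC'reg _ (phiC _ (Cg t))).
  apply: (curve_lift_admissible hchar hc) => // [m|t|].
  - have [G [hG GE]] := phireg m; have [p hp] := regular_fun_curve hG gpt gpoly.
    by exists p => t; rewrite -hp GE.
  - exact: hC'reg (phiC _ (Cg t)).
  have [G hG] := choice _ psireg.
  (* This is $F\circ\psi$ on $C'$, a left inverse of $\varphi\circ\gamma$; it is expanded in
     characters because [psi] is only known to pull back characters to regular functions. *)
  exists (fun x => \sum_(p <- s) p.1 * G p.2 x); split.
    by apply: regular_fun_sum => m; case: (hG m).
  move=> t; rewrite -[RHS]Fg FE //; apply: eq_bigr => p _.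
  by have [_ ->] := hG p.2; [rewrite psiK|apply: phiC].
have i_ e : (e < 4)%N -> (e < n)%N by move=> he; apply: leq_trans hdim.
have hu : uniq [:: Ordinal (i_ 0%N isT); Ordinal (i_ 1%N isT); Ordinal (i_ 2%N isT); Ordinal (i_ 3%N isT)].
  by [].
have [T [T' [hT hT' TK T'K TE]]] :=
  admissible_curves_equiv hchar hc (codim2_primitive_pair hchar hc hcodim) hdim hu hf hg.
have [Phi aPhi PhiE] := equivariant_automorphism hc hT hT' TK T'K.
exists Phi; split=> // x /gC [t ->].
by rewrite gE fE PhiE TE.
Qed.
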